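(* Let $\lambda$ be an infinite cardinal that is homogeneously characterizable. Then $\lambda^{\aleph_0}$ is completely characterizable.
   Context: All languages are countable; $L_{\omega_1,\omega}$ allows countable conjunctions/disjunctions and finite quantification. A sentence $\sigma\in L_{\omega_1,\omega}$ is complete if for every $L_{\omega_1,\omega}$-sentence $\tau$, either $\sigma\Rightarrow\tau$ or $\sigma\Rightarrow\neg\tau$ is valid. An infinite cardinal $\kappa$ is completely characterizable if there is a complete $L_{\omega_1,\omega}$-sentence with models in all infinite cardinalities $\le\kappa$ and no model of cardinality $\kappa^+$. A unary predicate $P$ is completely homogeneous for a structure $\mathcal A$ if $P^{\mathcal A}$ is infinite and every permutation of $P^{\mathcal A}$ extends to an automorphism of $\mathcal A$. The cardinal $\kappa$ is homogeneously characterizable if there are a complete $L_{\omega_1,\omega}$-sentence $\phi_\kappa$ and a unary predicate $P_\kappa$ in its language such that: $\phi_\kappa$ has no model of cardinality $>\kappa$; in the unique countable model $\mathcal M$ of $\phi_\kappa$, $P_\kappa$ is infinite and completely homogeneous for $\mathcal M$; and there is a model $\mathcal A$ of $\phi_\kappa$ with $|P_\kappa^{\mathcal A}|=\kappa$. *)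

(* Defs.v *)
From Stdlib Require Import Classical Fin.
Set Implicit Arguments.

Definition injective {A B} (f : A -> B) := forall x y, f x = f y -> x = y.
Definition surjective {A B} (f : A -> B) := forall y, exists x, f x = y.
Definition bijective {A B} (f : A -> B) := injective f /\ surjective f.

Definition le_card (A B : Type) : Prop := exists f : A -> B, injective f.
Definition same_card (A B : Type) : Prop := exists f : A -> B, bijective f.
Definition lt_card (A B : Type) : Prop := le_card A B /\ ~ le_card B A.
Definition infinite_type (A : Type) : Prop := le_card nat A.
Definition is_succ_card (K Y : Type) : Prop :=
  lt_card K Y /\ forall Z : Type, lt_card Z Y -> le_card Z K.

Record signature := {
  Rel : Type;  rel_ar : Rel -> nat;
  Fn  : Type;  fn_ar  : Fn -> nat;
  rel_countable : exists c : Rel -> nat, injective c;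
  fn_countable  : exists c : Fn -> nat, injective c }.

Section Syntax.
Variable S : signature.

Inductive term : Type :=
| tvar : nat -> term
| tapp : forall f : Fn S, (Fin.t (fn_ar S f) -> term) -> term.

Inductive form : Type :=
| feq   : term -> term -> form
| frel  : forall r : Rel S, (Fin.t (rel_ar S r) -> term) -> form
| fneg  : form -> form
| fconj : (nat -> form) -> form
| fdisj : (nat -> form) -> form
| fex   : nat -> form -> form
| fall  : nat -> form -> form.

Fixpoint tfree (t : term) (v : nat) : Prop :=
  match t with
  | tvar n => n = v
  | tapp f args => exists i, tfree (args i) v
  end.

Fixpoint free (phi : form) (v : nat) : Prop :=
  match phi with
  | feq t1 t2 => tfree t1 v \/ tfree t2 v
  | frel r args => exists i, tfree (args i) v
  | fneg p => free p v
  | fconj ps => exists n, free (ps n) v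
  | fdisj ps => exists n, free (ps n) v
  | fex x p => x <> v /\ free p v
  | fall x p => x <> v /\ free p v
  end.

(* a sentence: no free variables (this forces every subformula to have
   only finitely many free variables, as required in L_{omega1,omega}) *)
Definition sentence (phi : form) : Prop := forall v, ~ free phi v.

Record structure := {
  carrier :> Type;
  inhab : carrier;
  rel_int : forall r : Rel S, (Fin.t (rel_ar S r) -> carrier) -> Prop;
  fn_int  : forall f : Fn S, (Fin.t (fn_ar S f) -> carrier) -> carrier }.

Variable M : structure.

Fixpoint teval (a : nat -> M) (t : term) : M :=
  match t with
  | tvar n => a n
  | tapp f args => fn_int M f (fun i => teval a (args i))
  end.

Definition upd (a : nat -> M) (x : nat) (m : M) : nat -> M :=
  fun n => if PeanoNat.Nat.eqb n x then m else a n.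

Fixpoint holds (a : nat -> M) (phi : form) : Prop :=
  match phi with
  | feq t1 t2 => teval a t1 = teval a t2
  | frel r args => rel_int M r (fun i => teval a (args i))
  | fneg p => ~ holds a p
  | fconj ps => forall n, holds a (ps n)
  | fdisj ps => exists n, holds a (ps n)
  | fex x p => exists m, holds (upd a x m) p
  | fall x p => forall m, holds (upd a x m) p
  end.

Definition models (sigma : form) : Prop := holds (fun _ => inhab M) sigma.

(* interpretation of a unary predicate P (of arity 1) *)
Definition Pset (P : Rel S) (x : M) : Prop := rel_int M P (fun _ => x).

Definition automorphism (h : M -> M) : Prop :=
  bijective h /\
  (forall r args, rel_int M r args <-> rel_int M r (fun i => h (args i))) /\
  (forall f args, h (fn_int M f args) = fn_int M f (fun i => h (args i))).

Definition completely_homogeneous (P : Rel S) : Prop :=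
  infinite_type {x : M | Pset P x} /\
  forall g : {x : M | Pset P x} -> {x : M | Pset P x}, bijective g ->
    exists h : M -> M, automorphism h /\
      forall (x : M) (Hx : Pset P x), h x = proj1_sig (g (exist _ x Hx)).

End Syntax.

Definition complete (S : signature) (sigma : form S) : Prop :=
  forall tau : form S, sentence tau ->
    (forall M : structure S, models M sigma -> models M tau) \/
    (forall M : structure S, models M sigma -> ~ models M tau).

Definition completely_characterizable (K : Type) : Prop :=
  exists (S : signature) (sigma : form S),
    sentence sigma /\ complete sigma /\
    (forall X : Type, infinite_type X -> le_card X K ->
       exists M : structure S, models M sigma /\ same_card (carrier M) X) /\
    ~ (exists M : structure S, models M sigma /\ is_succ_card K (carrier M)).

Definition homogeneously_characterizable (K : Type) : Prop :=
  exists (S : signature) (phi : form S) (P : Rel S),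
    rel_ar S P = 1 /\ sentence phi /\ complete phi /\
    (forall M : structure S, models M phi -> le_card (carrier M) K) /\
    (exists M : structure S, models M phi /\ same_card (carrier M) nat) /\
    (forall M : structure S, models M phi -> same_card (carrier M) nat ->
       completely_homogeneous M P) /\
    (exists A : structure S, models A phi /\ same_card {x : A | Pset A P x} K).

(* Main.v *)
(* The characterizing sentence describes a tree of height omega together with a dense set of its
   branches. For every level n there is a sort carrying a model of the given sentence p, whose
   predicate P is the set of nodes of level n; every element outside the sorts is a branch b,
   determined by its nodes pr n b. The equivalence relations "same node of level n" on branches
   refine each other, and every node has infinitely many successors; no other condition is imposed
   on the set of branches. Hence a model injects into lambda^omega, and the full tree realizes this
   bound.
   Completeness: by Loewenheim-Skolem it is enough that two countable models are isomorphic. A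
   back-and-forth argument matches their branches, which determines a bijection of the nodes of
   each level. The level-n models of p are isomorphic because p is complete, and complete
   homogeneity of P corrects the isomorphism so that it extends that bijection.
   Smaller cardinalities are again obtained by Loewenheim-Skolem. *)
From Stdlib Require Import Classical ClassicalEpsilon FunctionalExtensionality ProofIrrelevance.
From Stdlib Require Import Arith Lia List Fin Cantor.
From Stdlib Require FinFun.
From mathcomp Require boolp classical_sets.
Require Import Defs.
Import ListNotations.

(** * Cardinals *)

(** The matching of branches prescribes a bijection of nodes on every level at once, while complete
    homogeneity extends only one permutation of [P] in one model. Separate copies of the model
    resolve this: no symbol relates two different sorts, so the isomorphism on one level can be
    corrected without disturbing the others, and only projections tie the sorts to the branches.
    That every path through the nodes be realized by a branch cannot be an axiom, since an
    infinitely splitting tree has uncountably many paths and a countable model has only countably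
    many branches. The axioms therefore ask just for what one step of the back-and-forth uses. The
    full tree needs as nodes of level [n] all sequences of length [n + 1] over lambda, and these
    must fill [P] exactly. This rests on lambda * lambda = lambda and on a model of [p] whose [P]
    has size lambda. The isomorphism of countable models of a complete sentence is derived from the
    isolation of types by single formulas in a countable structure, which is available because
    countable conjunctions are. *)

Lemma choice_fun (A B : Type) (R : A -> B -> Prop) :
  (forall x, exists y, R x y) -> exists f, forall x, R x (f x).
Proof.
  intros H. exists (fun x => proj1_sig (constructive_indefinite_description _ (H x))).
  intros x. exact (proj2_sig (constructive_indefinite_description _ (H x))).
Qed.

Lemma proj1_sig_inj (A : Type) (P : A -> Prop) (x y : {a | P a}) : proj1_sig x = proj1_sig y -> x = y.
Proof. destruct x, y. apply subset_eq_compat. Qed.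

(** The version of Zorn's lemma in [classical_sets] takes a boolean relation; [asbool] carries it
    over to [Prop]. As [R] is only a preorder, maximality is expressed without equality. *)
Lemma zorn_preorder (T : Type) (t0 : T) (R : T -> T -> Prop) :
  (forall t, R t t) -> (forall r s t, R r s -> R s t -> R r t) ->
  (forall A : T -> Prop, (forall s t, A s -> A t -> R s t \/ R t s) ->
     exists t, forall s, A s -> R s t) ->
  exists t, forall s, R t s -> R s t.
Proof.
  intros Hr Ht Hc.
  assert (E : forall x y, is_true (boolp.asbool (R x y)) = R x y)
    by (intros; apply boolp.asboolE).
  destruct (@classical_sets.ZL_preorder T t0 (fun x y => boolp.asbool (R x y))) as [t H].
  - intros t. rewrite E. apply Hr.
  - intros r s t. rewrite !E. apply Ht.
  - intros A HA. destruct (Hc A) as [t H].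
    + intros s t Hs Ht'. specialize (HA s t Hs Ht'). cbv beta in HA. rewrite !E in HA. exact HA.
    + exists t. intros s Hs. rewrite E. auto.
  - exists t. intros s Hs. specialize (H s). cbv beta in H. rewrite !E in H. auto.
Qed.

Lemma le_card_trans (A B C : Type) : le_card A B -> le_card B C -> le_card A C.
Proof.
  intros [f Hf] [g Hg]. exists (fun x => g (f x)). intros x y E. auto.
Qed.

(** Partial injections, as graphs ordered by inclusion, have a maximal member by Zorn's lemma. It is
    total or onto, since otherwise one more pair could be added. *)
Lemma le_card_total (A B : Type) : le_card A B \/ le_card B A.
Proof.
  pose (pinj := fun R : A -> B -> Prop =>
    (forall x y y', R x y -> R x y' -> y = y') /\ (forall x x' y, R x y -> R x' y -> x = x')).
  pose (T := {R | pinj R}).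
  assert (t0 : T). { exists (fun _ _ => False). split; intros; tauto. }
  destruct (@zorn_preorder T t0 (fun r s => forall x y, proj1_sig r x y -> proj1_sig s x y))
    as [[R [Rf Ri]] Rmax]; auto.
  - intros C HC.
    assert (U : pinj (fun x y => exists r : T, C r /\ proj1_sig r x y)).
    { split.
      - intros x y y' [r [Hr1 Hr2]] [s [Hs1 Hs2]].
        destruct (HC r s Hr1 Hs1); [destruct s as [s [s1 s2]]|destruct r as [r [s1 s2]]]; simpl in *; eauto.
      - intros x x' y [r [Hr1 Hr2]] [s [Hs1 Hs2]].
        destruct (HC r s Hr1 Hs1); [destruct s as [s [s1 s2]]|destruct r as [r [s1 s2]]]; simpl in *; eauto. }
    exists (exist _ _ U). simpl. eauto.
  - simpl in Rmax.
    destruct (classic (forall x, exists y, R x y)) as [Ht|Ht].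
    { left. destruct (choice_fun _ _ _ Ht) as [f Hf]. exists f. intros x x' E.
      apply (Ri x x' (f x)); auto. rewrite E. auto. }
    destruct (classic (forall y, exists x, R x y)) as [Hs|Hs].
    { right. destruct (choice_fun _ _ (fun y x => R x y) Hs) as [f Hf]. exists f. intros y y' E.
      apply (Rf (f y)); auto. rewrite E. auto. }
    exfalso.
    apply not_all_ex_not in Ht as [a Ha]. apply not_all_ex_not in Hs as [b Hb].
    assert (U : pinj (fun x y => R x y \/ (x = a /\ y = b))).
    { split.
      - intros x y y' [H|[-> ->]] [H'|[E ->]]; subst; auto; try (exfalso; eauto; fail). eapply Rf; eauto.
      - intros x x' y [H|[-> ->]] [H'|[-> E]]; subst; auto; try (exfalso; eauto; fail). eapply Ri; eauto. }
    apply Ha. exists b. apply (Rmax (exist _ _ U)); simpl; auto.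
Qed.

(** [S] collects the iterates, under [f] followed by [g], of the points outside the range of [g].
    The bijection is [f] on [S] and the inverse of [g] off [S]. *)
Lemma cantor_bernstein (A B : Type) : le_card A B -> le_card B A -> same_card A B.
Proof.
  intros [f Hf] [g Hg].
  pose (S := fun x => exists n x0, (forall y, g y <> x0) /\ Nat.iter n (fun z => g (f z)) x0 = x).
  assert (HS : forall x, ~ S x -> exists y, g y = x).
  { intros x Hx. apply NNPP. intros H. apply Hx. exists 0, x. split; auto. intros y E. eauto. }
  assert (H : forall x, exists y, (S x /\ y = f x) \/ (~ S x /\ g y = x)).
  { intros x. destruct (classic (S x)) as [H|H]; eauto. destruct (HS x H); eauto. }
  assert (gS : forall z, S z -> S (g (f z))).
  { intros z (n & x0 & H1 & H2). exists (Datatypes.S n), x0. simpl. rewrite H2. auto. }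
  destruct (choice_fun _ _ _ H) as [h Hh]. exists h. split.
  - intros x y E.
    destruct (Hh x) as [[H1 H2]|[H1 H2]], (Hh y) as [[H3 H4]|[H3 H4]].
    + apply Hf. congruence.
    + exfalso. apply H3. rewrite <- H4, <- E, H2. auto.
    + exfalso. apply H1. rewrite <- H2, E, H4. auto.
    + congruence.
  - intros y. destruct (classic (S (g y))) as [[n [x0 [H1 H2]]]|Hy].
    + destruct n as [|n]; simpl in H2; [exfalso; eapply H1; eauto|].
      apply Hg in H2. exists (Nat.iter n (fun z => g (f z)) x0).
      destruct (Hh (Nat.iter n (fun z => g (f z)) x0)) as [[H3 H4]|[H3 H4]]; [congruence|].
      exfalso. apply H3. exists n, x0. auto.
    + exists (g y). destruct (Hh (g y)) as [[H3 H4]|[H3 H4]]; [tauto|]. auto.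
Qed.

(* Zorn's lemma applied to injections [D * D -> D] with [D] a subset of [X] containing a copy of
   [nat]: for a maximal one the complement of [D] embeds into [D], since otherwise it contains a
   copy of [D] over which the injection can be extended. *)
Lemma infinite_square (X : Type) : infinite_type X -> le_card (X * X) X.
Proof.
  intros [i Hi].
  pose (good := fun p : (X -> Prop) * (X -> X -> X) =>
    (forall n, fst p (i n)) /\
    (forall x y, fst p x -> fst p y -> fst p (snd p x y)) /\
    (forall x y x' y', fst p x -> fst p y -> fst p x' -> fst p y' ->
       snd p x y = snd p x' y' -> x = x' /\ y = y')).
  pose (T := {p | good p}).
  assert (t0 : T).
  (* The starting point lives on the range of [i], to which Cantor's pairing of [nat] is
     transported; elsewhere the values are arbitrary. *)
  { assert (H : exists f : X -> X -> X, forall m n, f (i m) (i n) = i (to_nat (m, n))).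
    { destruct (choice_fun (X * X) X
        (fun p z => forall m n, p = (i m, i n) -> z = i (to_nat (m, n)))) as [f Hf].
      - intros [x y]. destruct (classic (exists m n, (x, y) = (i m, i n))) as [(m & n & E)|H].
        + exists (i (to_nat (m, n))). intros m' n' E'. rewrite E in E'. injection E' as E1 E2.
          apply Hi in E1, E2. subst. auto.
        + exists x. intros m n E. exfalso. eauto.
      - exists (fun x y => f (x, y)). intros. apply Hf. auto. }
    apply constructive_indefinite_description in H as [f Hf].
    exists (fun x => exists n, x = i n, f). repeat split; simpl.
    - eauto.
    - intros x y [m ->] [n ->]. rewrite Hf. eauto.
    - destruct H as [m ->], H0 as [n ->], H1 as [m' ->], H2 as [n' ->]. rewrite !Hf in H3.
      apply Hi in H3. apply (f_equal of_nat) in H3. rewrite !cancel_of_to in H3. congruence.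
    - destruct H as [m ->], H0 as [n ->], H1 as [m' ->], H2 as [n' ->]. rewrite !Hf in H3.
      apply Hi in H3. apply (f_equal of_nat) in H3. rewrite !cancel_of_to in H3. congruence. }
  pose (le := fun r s : T => 
    (forall x, fst (proj1_sig r) x -> fst (proj1_sig s) x) /\
    (forall x y, fst (proj1_sig r) x -> fst (proj1_sig r) y ->
       snd (proj1_sig r) x y = snd (proj1_sig s) x y)).
  destruct (@zorn_preorder T t0 le) as [top Dmax].
  - intros r. split; auto.
  - intros r s t [H1 H2] [H3 H4]. split; auto.
    intros x y Hx Hy. rewrite H2; auto.
  (* A nonempty chain is bounded by the union of the domains, with the common value of the functions
     on it. *)
  - intros C HC. destruct (classic (exists r, C r)) as [[r0 Hr0]|Hne];
      [|exists t0; intros s Hs; exfalso; eauto].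
    pose (D := fun x => exists r : T, C r /\ fst (proj1_sig r) x).
    assert (two : forall x y, D x -> D y -> exists r : T, C r /\ fst (proj1_sig r) x /\ fst (proj1_sig r) y).
    { intros x y [r [Hr Hx]] [s [Hs Hy]]. destruct (HC r s Hr Hs) as [H|H];
      [exists s | exists r]; split; auto; destruct r as [[? ?] ?], s as [[? ?] ?];
      unfold le in H; simpl in *; destruct H; auto. }
    assert (Hf : exists f : X -> X -> X, forall r : T, C r -> forall x y, fst (proj1_sig r) x ->
       fst (proj1_sig r) y -> f x y = snd (proj1_sig r) x y).
    { destruct (choice_fun (X * X) X (fun p z => forall r : T, C r ->
         fst (proj1_sig r) (fst p) -> fst (proj1_sig r) (snd p) ->
         z = snd (proj1_sig r) (fst p) (snd p))) as [f Hf].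
      - intros [x y]. simpl.
        destruct (classic (exists r : T, C r /\ fst (proj1_sig r) x /\ fst (proj1_sig r) y))
          as [[r [Hr [Hx Hy]]]|H].
        + exists (snd (proj1_sig r) x y). intros s Hs Hx' Hy'.
          destruct (HC r s Hr Hs) as [H|H]; destruct r as [[? ?] ?], s as [[? ?] ?];
          unfold le in H; simpl in *; destruct H as [H1 H2]; [|symmetry]; auto.
        + exists x. intros r Hr Hx Hy. exfalso. eauto.
      - exists (fun x y => f (x, y)). intros r Hr x y Hx Hy. exact (Hf (x, y) r Hr Hx Hy). }
    destruct Hf as [f Hf].
    assert (G : good (D, f)).
    { split; [|split]; simpl.
      - intros n. exists r0. split; auto. destruct r0 as [? [? ?]]. simpl. auto.
      - intros x y Hx Hy. destruct (two x y Hx Hy) as (r & Hr & Hx' & Hy'). exists r. split; auto.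
        rewrite (Hf r); auto. destruct r as [? (? & ? & ?)]. simpl in *. auto.
      - intros x y x' y' Hx Hy Hx' Hy' E.
        destruct (two x y Hx Hy) as (r & Hr & Hx1 & Hy1).
        destruct (two x' y' Hx' Hy') as (s & Hs & Hx2 & Hy2).
        rewrite (Hf r), (Hf s) in E; auto.
        destruct (HC r s Hr Hs) as [H|H];
          destruct r as [[? ?] (? & ? & ?)], s as [[? ?] (? & ? & ?)];
          unfold le in H; simpl in *; destruct H as [H1' H2'].
        + rewrite H2' in E; auto.
        + rewrite (H2' x' y') in E; auto. }
    exists (exist _ _ G). intros r Hr. pose proof (Hf r Hr) as Hfr.
    destruct r as [[E g] Gr] eqn:Er. unfold le; simpl in *. split.
    + intros x Hx. exists r. rewrite Er. split; auto.
    + intros x y Hx Hy. symmetry. auto.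
  - destruct top as [[D f] (G1 & G2 & G3)]. simpl in *.
    destruct (le_card_total {x | D x} {x | ~ D x}) as [[k Hk]|[k Hk]].
    + exfalso.
      assert (Hc : exists c : X -> X, (forall x, D x -> ~ D (c x)) /\
          forall x y, D x -> D y -> c x = c y -> x = y).
      { destruct (choice_fun X X (fun x z => forall H : D x, z = proj1_sig (k (exist _ x H)))) as [c Hc].
        - intros x. destruct (classic (D x)) as [H|H].
          + exists (proj1_sig (k (exist _ x H))). intros H'. rewrite (proof_irrelevance _ H H'). auto.
          + exists x. intros; tauto.
        - exists c. split.
          + intros x H. rewrite (Hc x H). apply (proj2_sig (k _)).
          + intros x y Hx Hy. rewrite (Hc x Hx), (Hc y Hy). intros E.
            apply proj1_sig_inj, Hk in E. congruence. }
      destruct Hc as (c & Hc1 & Hc2).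
      (* [c] copies [D] into its complement and [E] adds that copy. An element of [E] amounts to a
         bit and an element of [D], which [dec] recovers. *)
      pose (E := fun x => D x \/ exists d, D d /\ x = c d).
      assert (Hdec : exists dec : X -> nat * X, forall x, E x -> D (snd (dec x)) /\ fst (dec x) < 2 /\
         forall y, E y -> dec x = dec y -> x = y).
      { destruct (choice_fun X (nat * X) (fun x p => E x -> D (snd p) /\
          ((fst p = 0 /\ x = snd p) \/ (fst p = 1 /\ x = c (snd p))))) as [dec Hd].
        - intros x. destruct (classic (E x)) as [[H|(d & Hd & ->)]|H].
          + exists (0, x). simpl. auto.
          + exists (1, d). simpl. auto.
          + exists (0, x). tauto.
        - exists dec. intros x Hx. destruct (Hd x Hx) as [H1 H2]. split; auto. split; [lia|].
          intros y Hy Exy. destruct (Hd y Hy) as [H3 H4]. rewrite <- Exy in H4.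
          destruct H2 as [[? ?]|[? ?]], H4 as [[? ?]|[? ?]]; congruence || lia. }
      destruct Hdec as [dec Hdec].
      (* Two bits and two elements of [D] are coded inside [D] by [f] and then moved by [c], so the
         new values avoid those of [f] on [D]. The bits are below 2, hence twice the first plus the
         second determines both. *)
      pose (new := fun x y => c (f (i (2 * fst (dec x) + fst (dec y))) (f (snd (dec x)) (snd (dec y))))).
      destruct (choice_fun (X * X) X (fun p z =>
          (D (fst p) /\ D (snd p) -> z = f (fst p) (snd p)) /\
          (~ (D (fst p) /\ D (snd p)) -> z = new (fst p) (snd p)))) as [g Hg].
      { intros [x y]. simpl. destruct (classic (D x /\ D y));
          [exists (f x y) | exists (new x y)]; tauto. }
      assert (newD : forall x y, E x -> E y ->
          D (f (i (2 * fst (dec x) + fst (dec y))) (f (snd (dec x)) (snd (dec y))))).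
      { intros x y Hx Hy. destruct (Hdec x Hx), (Hdec y Hy). auto. }
      assert (G : good (E, fun x y => g (x, y))).
      { split; [|split]; simpl.
        - intros n. left. auto.
        - intros x y Hx Hy. destruct (Hg (x, y)) as [Hg1 Hg2]; simpl in *.
          destruct (classic (D x /\ D y)) as [H|H].
          + rewrite Hg1; auto. left. apply G2; tauto.
          + rewrite Hg2; auto. right. eexists. split; [|reflexivity]. auto.
        - intros x y x' y' Hx Hy Hx' Hy' Eg.
          destruct (Hg (x, y)) as [Hg1 Hg2], (Hg (x', y')) as [Hg3 Hg4]; simpl in *.
          destruct (classic (D x /\ D y)) as [H|H], (classic (D x' /\ D y')) as [H'|H'].
          + rewrite Hg1, Hg3 in Eg; auto. apply G3; tauto.
          + rewrite Hg1, Hg4 in Eg; auto. exfalso. apply (Hc1 _ (newD x' y' Hx' Hy')).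
            change (D (new x' y')). rewrite <- Eg. apply G2; tauto.
          + rewrite Hg2, Hg3 in Eg; auto. exfalso. apply (Hc1 _ (newD x y Hx Hy)).
            change (D (new x y)). rewrite Eg. apply G2; tauto.
          + rewrite Hg2, Hg4 in Eg; auto. apply Hc2 in Eg; auto.
            destruct (Hdec x Hx) as (a1 & a2 & a3), (Hdec y Hy) as (b1 & b2 & b3),
              (Hdec x' Hx') as (c1 & c2 & c3), (Hdec y' Hy') as (d1 & d2 & d3).
            apply G3 in Eg; auto. destruct Eg as [Eg1 Eg2]. apply Hi in Eg1.
            apply G3 in Eg2; auto. destruct Eg2 as [Eg2 Eg3].
            split; [apply a3|apply b3]; auto.
            * rewrite (surjective_pairing (dec x)), (surjective_pairing (dec x')). f_equal; auto. lia.
            * rewrite (surjective_pairing (dec y)), (surjective_pairing (dec y')). f_equal; auto. lia. }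
      specialize (Dmax (exist _ _ G)). unfold le in Dmax; simpl in Dmax.
      destruct Dmax as [Dm _].
      * split; [intros; left; auto|]. intros x y Hx Hy. symmetry. apply (Hg (x, y)). auto.
      * apply (Hc1 (i 0)); auto. apply Dm. right. eauto.
    (* The tags [i 0] and [i 1] for elements inside and outside [D] give an injection [u] of all of
       [X] into [D], where [f] forms pairs. *)
    + destruct (choice_fun X X (fun x z => D z /\ ((D x /\ z = f (i 0) x) \/
         (exists H : ~ D x, z = f (i 1) (proj1_sig (k (exist _ x H))))))) as [u Hu].
      { intros x. destruct (classic (D x)) as [H|H].
        - exists (f (i 0) x). auto.
        - exists (f (i 1) (proj1_sig (k (exist _ x H)))). split; [|right; eauto].
          apply G2; auto. apply (proj2_sig (k _)). }
      assert (ui : forall x y, u x = u y -> x = y).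
      { assert (i01 : i 0 <> i 1) by (intros E; apply Hi in E; discriminate).
        assert (Dk : forall z, D (proj1_sig (k z))) by (intros z; apply (proj2_sig (k z))).
        intros x y E. destruct (Hu x) as [_ [[H1 H2]|[H1 H2]]], (Hu y) as [_ [[H3 H4]|[H3 H4]]];
          rewrite H2, H4 in E; apply G3 in E; auto; destruct E as [E1 E2]; auto; try congruence.
        apply proj1_sig_inj, Hk in E2. congruence. }
      exists (fun p => f (u (fst p)) (u (snd p))). intros [x y] [x' y'] E. simpl in E.
      apply G3 in E; try apply Hu. destruct E as [E1 E2]. apply ui in E1, E2. congruence.
Qed.

Lemma le_card_list (X Y : Type) : le_card X Y -> le_card (list X) (list Y).
Proof.
  intros [f Hf]. exists (map f). intros l. induction l as [|x l IH]; intros [|y l'] E; try discriminate; auto.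
  injection E as E1 E2. apply Hf in E1. apply IH in E2. congruence.
Qed.

Lemma infinite_list (X : Type) : infinite_type X -> le_card (list X) X.
Proof.
  intros HX. pose proof HX as [i Hi]. destruct (infinite_square _ HX) as [p Hp].
  (* The tags [i 0] and [i 1] keep the code of the empty list apart from the codes of nonempty
     ones. *)
  exists (fix g l := match l with [] => p (i 0, i 0) | x :: l' => p (i 1, p (x, g l')) end).
  intros l. induction l as [|x l IH]; intros [|y l'] E; auto; apply Hp in E; injection E.
  - intros _ E1. apply Hi in E1. discriminate.
  - intros _ E1. apply Hi in E1. discriminate.
  - intros E1. apply Hp in E1. injection E1 as E1 E2. intros. apply IH in E2. congruence.
Qed.

Lemma infinite_sum (X Y : Type) : infinite_type X -> le_card Y X -> le_card (X + Y) X.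
Proof.
  intros HX [j Hj]. pose proof HX as [i Hi]. destruct (infinite_square _ HX) as [p Hp].
  exists (fun z => match z with inl x => p (i 0, x) | inr y => p (i 1, j y) end).
  intros [x|x] [y|y] E; apply Hp, pair_equal_spec in E as [E1 E2];
    try (apply Hi in E1; discriminate); try apply Hj in E2; congruence.
Qed.

(** * Downward Loewenheim-Skolem *)

(** Only the first [k] values of an assignment matter, so a witness depends on a finite list. In a
    sentence every subformula has such a bound. *)
Definition free_below (S : signature) (k : nat) (p : form S) : Prop := forall v, free p v -> v < k.
Arguments free_below {S} k p.

Lemma teval_ext (S : signature) (M : structure S) (a b : nat -> M) (t : term S) :
  (forall v, tfree t v -> a v = b v) -> teval M a t = teval M b t.
Proof.
  induction t as [n|f args IH]; simpl; intros H; auto.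
  f_equal. apply functional_extensionality. intros i. apply IH. eauto.
Qed.

Lemma holds_ext (S : signature) (M : structure S) (p : form S) :
  forall a b : nat -> M, (forall v, free p v -> a v = b v) -> (holds M a p <-> holds M b p).
Proof.
  assert (Hupd : forall (x : nat) (p : form S) (a b : nat -> M), (forall v, x <> v /\ free p v -> a v = b v) ->
      forall m v, free p v -> upd M a x m v = upd M b x m v).
  { intros x q a b H m v Hv. unfold upd. destruct (Nat.eqb_spec v x); auto. }
  induction p as [t1 t2|r args|p IH|ps IH|ps IH|x p IH|x p IH]; simpl; intros a b H.
  - rewrite (teval_ext S M a b t1), (teval_ext S M a b t2); auto. tauto.
  - replace (fun i => teval M b (args i)) with (fun i => teval M a (args i)); [tauto|].
    apply functional_extensionality. intros i. apply teval_ext. eauto.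
  - rewrite (IH a b); auto. tauto.
  - assert (H' : forall n, holds M a (ps n) <-> holds M b (ps n)) by eauto.
    split; intros G n; apply H'; auto.
  - assert (H' : forall n, holds M a (ps n) <-> holds M b (ps n)) by eauto.
    split; intros [n G]; exists n; apply H'; auto.
  - assert (H' : forall m, holds M (upd M a x m) p <-> holds M (upd M b x m) p) by eauto.
    split; intros [m G]; exists m; apply H'; auto.
  - assert (H' : forall m, holds M (upd M a x m) p <-> holds M (upd M b x m) p) by eauto.
    split; intros G m; apply H'; auto.
Qed.

Lemma sentence_holds (S : signature) (M : structure S) (p : form S) (a : nat -> M) :
  sentence p -> (holds M a p <-> models M p).
Proof. intros Hp. apply holds_ext. intros v Hv. destruct (Hp v Hv). Qed.

Definition ordinal {k : nat} (i : Fin.t k) : nat := proj1_sig (Fin.to_nat i).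

Definition extend {k : nat} {A : Type} (d : A) (args : Fin.t k -> A) (n : nat) : A :=
  match lt_dec n k with left H => args (Fin.of_nat_lt H) | right _ => d end.

Lemma ordinal_lt (k : nat) (i : Fin.t k) : ordinal i < k.
Proof. exact (proj2_sig (Fin.to_nat i)). Qed.

Lemma extend_ordinal (k : nat) (A : Type) (d : A) (args : Fin.t k -> A) (i : Fin.t k) :
  extend d args (ordinal i) = args i.
Proof.
  unfold extend. pose proof (ordinal_lt _ i) as H. destruct (lt_dec (ordinal i) k) as [H'|]; [|tauto].
  f_equal. apply Fin.to_nat_inj. rewrite Fin.to_nat_of_nat. reflexivity.
Qed.

Lemma ordinal_surj (k n : nat) : n < k -> exists i : Fin.t k, ordinal i = n.
Proof.
  intros H. exists (Fin.of_nat_lt H). unfold ordinal. rewrite Fin.to_nat_of_nat. reflexivity.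
Qed.

Lemma nth_map_seq (A : Type) (a : nat -> A) (k v : nat) (d : A) : v < k -> nth v (map a (seq 0 k)) d = a v.
Proof.
  intros H. rewrite nth_indep with (d' := a 0) by (rewrite length_map, length_seq; auto).
  rewrite map_nth, seq_nth; auto.
Qed.

Definition embedding (S : signature) (N M : structure S) (e : N -> M) : Prop :=
  injective e /\
  (forall r args, rel_int N r args <-> rel_int M r (fun i => e (args i))) /\
  (forall f args, e (fn_int N f args) = fn_int M f (fun i => e (args i))).
Arguments embedding {S N M} e.

Lemma embedding_teval (S : signature) (N M : structure S) (e : N -> M) (a : nat -> N) (t : term S) :
  embedding e -> e (teval N a t) = teval M (fun v => e (a v)) t.
Proof.
  intros (_ & _ & Hf). induction t as [n|f args IH]; simpl; auto.
  rewrite Hf. f_equal. apply functional_extensionality. auto.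
Qed.

Lemma upd_map (S : signature) (N M : structure S) (e : N -> M) (a : nat -> N) (x : nat) (m : N) :
  (fun v => e (upd N a x m v)) = upd M (fun v => e (a v)) x (e m).
Proof.
  apply functional_extensionality. intros v. unfold upd. destruct (Nat.eqb v x); auto.
Qed.

(* [F] bundles Skolem functions for all subformulas of [p]. *)
Lemma skolem_functions (S : signature) (M : structure S) (p : form S) :
  (exists k, free_below k p) ->
  exists F : nat -> list M -> M, forall (N : structure S) (e : N -> M), embedding e ->
    (forall c l, exists y, F c (map e l) = e y) ->
    forall a, holds N a p <-> holds M (fun v => e (a v)) p.
Proof.
  (* With [neg] the identity, [w] finds witnesses of an existential; with [neg] the negation,
     counterexamples to a universal. The list argument of [w] holds the first [k] values of the
     assignment. *)
  assert (Hquant : forall (x k : nat) (p : form S) (neg : Prop -> Prop), 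
    (forall v, x <> v /\ free p v -> v < k) -> (forall P Q : Prop, (P <-> Q) -> neg P -> neg Q) ->
    exists w : list M -> M, forall (N : structure S) (e : N -> M), (forall l, exists y, w (map e l) = e y) ->
    forall (a : nat -> N), (exists m, neg (holds M (upd M (fun v => e (a v)) x m) p)) ->
      exists n, neg (holds M (upd M (fun v => e (a v)) x (e n)) p)).
  { intros x k q neg Hk Hneg.
    pose (asg := fun l : list M => fun v => nth v l (inhab M)).
    destruct (choice_fun (list M) M (fun l m => forall m', neg (holds M (upd M (asg l) x m') q) ->
        neg (holds M (upd M (asg l) x m) q))) as [w Hw].
    { intros l. destruct (classic (exists m, neg (holds M (upd M (asg l) x m) q))) as [[m H]|H]; eauto.
      exists (inhab M). intros m' H'. exfalso. eauto. }
    exists w. intros N e He a [m Hm].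
    pose (l := map a (seq 0 k)).
    assert (Hl : forall m, holds M (upd M (fun v => e (a v)) x m) q <-> holds M (upd M (asg (map e l)) x m) q).
    { intros m'. apply holds_ext. intros v Hv. unfold upd. destruct (Nat.eqb_spec v x); auto.
      unfold asg, l. rewrite map_map. symmetry. apply nth_map_seq with (a := fun v => e (a v)). auto. }
    destruct (He l) as [n Hn]. exists n. rewrite <- Hn.
    eapply Hneg; [symmetry; apply Hl|]. eapply Hw. eapply Hneg; [apply Hl|exact Hm]. }
  induction p as [t1 t2|r args|p IH|ps IH|ps IH|x p IH|x p IH]; intros [k Hk].
  - exists (fun _ _ => inhab M). intros N e He _ a. simpl. rewrite <- !embedding_teval; auto.
    split; intros H; [congruence|]. apply He. auto.
  - exists (fun _ _ => inhab M). intros N e He _ a. simpl. rewrite (proj1 (proj2 He)).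
    replace (fun i => e (teval N a (args i))) with (fun i => teval M (fun v => e (a v)) (args i)); [tauto|].
    apply functional_extensionality. intros i. symmetry. apply embedding_teval; auto.
  - destruct IH as [F HF]; [exists k; auto|]. exists F. intros N e He HN a. simpl. rewrite (HF N e); auto. tauto.
  - destruct (choice_fun _ _ _ (fun n => IH n (ex_intro _ k (fun v Hv => Hk v (ex_intro _ n Hv))))) as [F HF].
    (* A code is a pair: the index of a conjunct, and a code of one of its Skolem functions. *)
    exists (fun c => F (fst (of_nat c)) (snd (of_nat c))). intros N e He HN a. simpl.
    assert (H : forall n, holds N a (ps n) <-> holds M (fun v => e (a v)) (ps n)).
    { intros n. apply HF; auto. intros c l. specialize (HN (to_nat (n, c)) l).
      rewrite cancel_of_to in HN. auto. }
    split; intros G n; apply H; auto.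
  - destruct (choice_fun _ _ _ (fun n => IH n (ex_intro _ k (fun v Hv => Hk v (ex_intro _ n Hv))))) as [F HF].
    exists (fun c => F (fst (of_nat c)) (snd (of_nat c))). intros N e He HN a. simpl.
    assert (H : forall n, holds N a (ps n) <-> holds M (fun v => e (a v)) (ps n)).
    { intros n. apply HF; auto. intros c l. specialize (HN (to_nat (n, c)) l).
      rewrite cancel_of_to in HN. auto. }
    split; intros [n G]; exists n; apply H; auto.
  - destruct IH as [F HF].
    (* The quantified variable [x] may be free in the body, so the bound has to exceed it too. *)
    { exists (Datatypes.S (Nat.max x k)). intros v Hv. destruct (Nat.eq_dec x v); [lia|].
      specialize (Hk v (conj n Hv)). lia. }
    destruct (Hquant x k p (fun P => P)) as [w Hw]; auto; [tauto|].
    (* Code 0 is the new witness function; the successors are the codes of the body. *)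
    exists (fun c => match c with 0 => w | Datatypes.S c => F c end). intros N e He HN a.
    assert (HF' : forall m, holds N (upd N a x m) p <-> holds M (upd M (fun v => e (a v)) x (e m)) p).
    { intros m. rewrite <- upd_map. apply HF; auto. intros c. apply (HN (Datatypes.S c)). }
    simpl. split.
    + intros [m Hm]. exists (e m). apply HF'. auto.
    + intros Hm. apply Hw in Hm; [|apply (HN 0)]. destruct Hm as [m Hm]. exists m. apply HF'. auto.
  - destruct IH as [F HF].
    { exists (Datatypes.S (Nat.max x k)). intros v Hv. destruct (Nat.eq_dec x v); [lia|].
      specialize (Hk v (conj n Hv)). lia. }
    destruct (Hquant x k p not) as [w Hw]; auto; [tauto|].
    exists (fun c => match c with 0 => w | Datatypes.S c => F c end). intros N e He HN a.
    assert (HF' : forall m, holds N (upd N a x m) p <-> holds M (upd M (fun v => e (a v)) x (e m)) p).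
    { intros m. rewrite <- upd_map. apply HF; auto. intros c. apply (HN (Datatypes.S c)). }
    simpl. split.
    + intros H. apply NNPP. intros Hm. apply not_all_ex_not in Hm. apply Hw in Hm; [|apply (HN 0)].
      destruct Hm as [m Hm]. apply Hm, HF'. auto.
    + intros H m. apply HF'. auto.
Qed.

(* Elements of the hull are named by words in reverse Polish notation. *)
Lemma hull (A X : Type) (j : X -> A) (G : nat -> list A -> A) :
  infinite_type X ->
  exists D : A -> Prop, (forall x, D (j x)) /\ (forall c l, Forall D l -> D (G c l)) /\
    le_card {a | D a} X.
Proof.
  intros HX.
  (* A stack machine: a generator is pushed, and [(c, k)] replaces the top [k] entries by a value of
     [G c]. The top entry is the last argument, hence [rev]. *)
  pose (run := fix run (w : list (X + nat * nat)) (s : list A) : list A :=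
    match w with
    | [] => s
    | inl x :: w => run w (j x :: s)
    | inr (c, k) :: w => run w (G c (rev (firstn k s)) :: skipn k s)
    end).
  assert (run_app : forall w w' s, run (w ++ w') s = run w' (run w s)).
  { induction w as [|[x|[c k]] w IH]; simpl; auto. }
  pose (D := fun a => exists w, forall s, run w s = a :: s).
  exists D. split; [|split].
  - intros x. exists [inl x]. auto.
  - intros c l Hl.
    assert (H : exists w, forall s, run w s = rev l ++ s).
    { induction Hl as [|a l [w Hw] Hl [w' Hw']].
      - exists []. auto.
      - exists (w ++ w'). intros s. rewrite run_app, Hw, Hw'. simpl. rewrite <- app_assoc. auto. }
    destruct H as [w Hw]. exists (w ++ [inr (c, length l)]). intros s. rewrite run_app, Hw. simpl.
    rewrite <- length_rev. rewrite firstn_app, skipn_app, Nat.sub_diag, firstn_all, skipn_all. simpl.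
    rewrite app_nil_r, rev_involutive. auto.
  (* A word determines the element that it names, and the alphabet is no larger than [X]. *)
  - apply le_card_trans with (list (X + nat * nat)).
    + destruct (choice_fun {a | D a} _ (fun a w => forall s, run w s = proj1_sig a :: s)) as [f Hf].
      { intros [a Ha]. exact Ha. }
      exists f. intros a b E. pose proof (Hf a []) as H1. pose proof (Hf b []) as H2. rewrite E, H2 in H1.
      injection H1 as H1. apply proj1_sig_inj. auto.
    + eapply le_card_trans; [|apply infinite_list; auto]. apply le_card_list, infinite_sum; auto.
      eapply le_card_trans; [|exact HX]. exists to_nat. intros x y E.
      rewrite <- (cancel_of_to x), E. apply cancel_of_to.
Qed.

(** [N] is the hull of a copy of [X] in [M] under the Skolem functions of [p] and the function
    symbols. There are countably many of these, so the hull has exactly the size of [X]. *)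
Theorem lowenheim_skolem (S : signature) (M : structure S) (p : form S) (X : Type) :
  sentence p -> infinite_type X -> le_card X M ->
  exists N : structure S, (models N p <-> models M p) /\ same_card N X.
Proof.
  intros Hp HX [j Hj].
  destruct (skolem_functions S M p) as [F HF]; [exists 0; intros v Hv; destruct (Hp v Hv)|].
  destruct (fn_countable S) as [code Hcode].
  (* All function symbols are merged into one operation on a code and a list; [inhab M] stands in
     for codes of no symbol and for missing arguments. *)
  destruct (choice_fun (nat * list M) M (fun cl m => forall f, code f = fst cl ->
      m = fn_int M f (fun i => nth (ordinal i) (snd cl) (inhab M)))) as [Gf HGf].
  { intros [c l]. destruct (classic (exists f, code f = c)) as [[f <-]|H].
    - eexists. intros g E. simpl in E. apply Hcode in E. subst. reflexivity.
    - exists (inhab M). intros f E. exfalso. eauto. }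
  (* Pairs with first entry 0 select Skolem functions, all others function symbols. *)
  destruct (hull M X j (fun c l => match of_nat c with (0, d) => F d l | (_, d) => Gf (d, l) end) HX)
    as (D & Dj & DG & Dcard).
  assert (DF : forall c l, Forall D l -> D (F c l)).
  { intros c l Hl. specialize (DG (to_nat (0, c)) l Hl). rewrite cancel_of_to in DG. auto. }
  assert (Df : forall f args, (forall i, D (args i)) -> D (fn_int M f args)).
  { intros f args H. destruct HX as [i _].
    pose (l := map (extend (j (i 0)) args) (seq 0 (fn_ar S f))).
    specialize (DG (to_nat (1, code f)) l). rewrite cancel_of_to, (HGf (code f, l) f eq_refl) in DG.
    replace args with (fun i : Fin.t (fn_ar S f) => nth (ordinal i) l (inhab M)).
    - apply DG. apply Forall_forall. intros m Hm. apply in_map_iff in Hm as (n & <- & _).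
      unfold extend. destruct (lt_dec n (fn_ar S f)); auto.
    - apply functional_extensionality. intros k. unfold l.
      rewrite nth_map_seq by apply ordinal_lt. apply extend_ordinal. }
  assert (d0 : exists d, D d) by (destruct HX as [i _]; exists (j (i 0)); auto).
  apply constructive_indefinite_description in d0.
  pose (N := @Build_structure S {a | D a} (exist _ (proj1_sig d0) (proj2_sig d0))
    (fun r args => rel_int M r (fun i => proj1_sig (args i)))
    (fun f args => exist _ (fn_int M f (fun i => proj1_sig (args i)))
                     (Df f _ (fun i => proj2_sig (args i))))).
  assert (HN : @embedding S N M (@proj1_sig M D)).
  { split; [|split]; simpl; try tauto. intros a b. apply proj1_sig_inj. }
  exists N. split.
  - unfold models. rewrite (HF N (@proj1_sig M D) HN).
    + apply sentence_holds. auto.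
    + intros c l. assert (H : D (F c (map (@proj1_sig M D) l))).
      { apply DF, Forall_forall. intros m Hm. apply in_map_iff in Hm as (n & <- & _). apply proj2_sig. }
      exists (exist _ _ H). reflexivity.
  - apply cantor_bernstein; auto. exists (fun x => exist _ (j x) (Dj x)).
    intros x y E. apply Hj. congruence.
Qed.

(** * Countable models of a complete sentence *)

(** The isomorphism is given by its graph: this is what a back-and-forth construction produces, and
    it treats both sides alike. *)
Definition isomorphism (S : signature) (M N : structure S) (R : M -> N -> Prop) : Prop :=
  (forall x, exists y, R x y) /\ (forall y, exists x, R x y) /\
  (forall x y x' y', R x y -> R x' y' -> (x = x' <-> y = y')) /\
  (forall r a b, (forall i, R (a i) (b i)) -> (rel_int M r a <-> rel_int N r b)) /\
  (forall f a b, (forall i, R (a i) (b i)) -> R (fn_int M f a) (fn_int N f b)).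
Arguments isomorphism {S M N} R.

Lemma isomorphism_holds (S : signature) (M N : structure S) (R : M -> N -> Prop) (p : form S) :
  isomorphism R -> forall a b, (forall v, R (a v) (b v)) -> (holds M a p <-> holds N b p).
Proof.
  intros (R1 & R2 & R3 & R4 & R5).
  assert (Ht : forall a b, (forall v, R (a v) (b v)) -> forall t, R (teval M a t) (teval N b t)).
  { intros a b H t. induction t; simpl; auto. }
  assert (Hu : forall a b x m n, (forall v, R (a v) (b v)) -> R m n ->
      forall v, R (upd M a x m v) (upd N b x n v)).
  { intros a b x m n H Hm v. unfold upd. destruct (Nat.eqb v x); auto. }
  induction p as [t1 t2|r args|p IH|ps IH|ps IH|x p IH|x p IH]; simpl; intros a b H.
  - apply R3; auto.
  - apply R4; auto.
  - rewrite (IH a b); tauto.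
  - split; intros G n; apply (IH n a b); auto.
  - split; intros [n G]; exists n; apply (IH n a b); auto.
  - split.
    + intros [m G]. destruct (R1 m) as [n Hn]. exists n. apply (IH (upd M a x m) (upd N b x n)); auto.
    + intros [n G]. destruct (R2 n) as [m Hm]. exists m. apply (IH (upd M a x m) (upd N b x n)); auto.
  - split.
    + intros G n. destruct (R2 n) as [m Hm]. apply (IH (upd M a x m) (upd N b x n)); auto.
    + intros G m. destruct (R1 m) as [n Hn]. apply (IH (upd M a x m) (upd N b x n)); auto.
Qed.

Lemma isomorphism_models (S : signature) (M N : structure S) (R : M -> N -> Prop) (p : form S) :
  isomorphism R -> sentence p -> (models M p <-> models N p).
Proof.
  intros HR Hp. destruct (proj1 HR (inhab M)) as [n Hn].
  rewrite <- (sentence_holds _ N p (fun _ => n) Hp). apply (isomorphism_holds _ _ _ R); auto.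
Qed.

(** Stage [n] of a growing chain of good lists takes care of [u n] and [v n]. [G] need not pass to
    sublists, so a finite part of [R] is only said to lie inside some good list. *)
Lemma back_and_forth (X Y : Type) (u : nat -> X) (v : nat -> Y) (G : list (X * Y) -> Prop) :
  surjective u -> surjective v -> G [] ->
  (forall l x, G l -> exists y, G ((x, y) :: l)) ->
  (forall l y, G l -> exists x, G ((x, y) :: l)) ->
  exists R : X -> Y -> Prop, (forall x, exists y, R x y) /\ (forall y, exists x, R x y) /\
    forall l, (forall x y, In (x, y) l -> R x y) -> exists l', G l' /\ incl l l'.
Proof.
  intros Hu Hv G0 Gf Gb.
  assert (step : forall q : {l | G l} * nat, exists r : {l | G l}, incl (proj1_sig (fst q)) (proj1_sig r) /\
     (exists y, In (u (snd q), y) (proj1_sig r)) /\ (exists x, In (x, v (snd q)) (proj1_sig r))).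
  { intros [[l Hl] n]. destruct (Gf l (u n) Hl) as [y Hy]. destruct (Gb _ (v n) Hy) as [x Hx].
    exists (exist _ _ Hx). simpl. split; [|split]; eauto.
    intros p Hp. simpl. auto. }
  destruct (choice_fun _ _ _ step) as [next Hnext].
  pose (s := nat_rect (fun _ => {l | G l}) (exist _ [] G0) (fun n l => next (l, n))).
  exists (fun x y => exists n, In (x, y) (proj1_sig (s n))). split; [|split].
  - intros x. destruct (Hu x) as [n <-]. destruct (Hnext (s n, n)) as (_ & [y Hy] & _).
    exists y, (Datatypes.S n). exact Hy.
  - intros y. destruct (Hv y) as [n <-]. destruct (Hnext (s n, n)) as (_ & _ & [x Hx]).
    exists x, (Datatypes.S n). exact Hx.
  - assert (mono : forall n m, n <= m -> incl (proj1_sig (s n)) (proj1_sig (s m))).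
    { intros n m H. induction H; [apply incl_refl|]. eapply incl_tran; eauto.
      exact (proj1 (Hnext (s m, m))). }
    intros l Hl. cut (exists n, incl l (proj1_sig (s n))).
    { intros [n Hn]. exists (proj1_sig (s n)). split; auto. apply proj2_sig. }
    induction l as [|[x y] l IH]; [exists 0; intros p []|].
    destruct IH as [n Hn]; [intros; apply Hl; simpl; auto|].
    destruct (Hl x y) as [m Hm]; [simpl; auto|].
    exists (Nat.max n m). intros p [<-|Hp].
    + apply (mono m); [lia|auto].
    + apply (mono n); [lia|auto].
Qed.

(** * Derived connectives and universal closures *)

Definition ftrue {S : signature} : form S := fall 0 (feq (tvar S 0) (tvar S 0)).
Definition fand {S : signature} (p q : form S) : form S :=
  fconj (fun n => match n with 0 => p | _ => q end).
Definition fimp {S : signature} (p q : form S) : form S :=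
  fdisj (fun n => match n with 0 => fneg p | _ => q end).

Fixpoint foralls {S : signature} (k : nat) (p : form S) : form S :=
  match k with 0 => p | Datatypes.S k => foralls k (fall k p) end.

Lemma free_ftrue (S : signature) (v : nat) : free (@ftrue S) v <-> False.
Proof. simpl. lia. Qed.

Lemma free_fand (S : signature) (p q : form S) (v : nat) : free (fand p q) v <-> free p v \/ free q v.
Proof.
  simpl. split; [intros [[|n] H]; auto|]. intros [H|H]; [exists 0|exists 1]; auto.
Qed.

Lemma free_fimp (S : signature) (p q : form S) (v : nat) : free (fimp p q) v <-> free p v \/ free q v.
Proof.
  simpl. split; [intros [[|n] H]; auto|]. intros [H|H]; [exists 0|exists 1]; auto.
Qed.

Lemma holds_ftrue (S : signature) (M : structure S) (a : nat -> M) : holds M a ftrue.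
Proof. simpl. auto. Qed.

Lemma holds_fand (S : signature) (M : structure S) (p q : form S) (a : nat -> M) :
  holds M a (fand p q) <-> holds M a p /\ holds M a q.
Proof.
  simpl. split; [intros H; split; [apply (H 0)|apply (H 1)]|]. intros [H1 H2] [|n]; auto.
Qed.

Lemma holds_fimp (S : signature) (M : structure S) (p q : form S) (a : nat -> M) :
  holds M a (fimp p q) <-> (holds M a p -> holds M a q).
Proof.
  simpl. split; [intros [[|n] H]; simpl in H; tauto|].
  intros H. destruct (classic (holds M a p)); [exists 1|exists 0]; simpl; auto.
Qed.

Lemma free_foralls (S : signature) (k : nat) (p : form S) (v : nat) :
  free (foralls k p) v -> k <= v /\ free p v.
Proof.
  revert p. induction k as [|k IH]; simpl; intros p H; [split; auto; lia|].
  apply IH in H. simpl in H. split; [lia|tauto].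
Qed.

Lemma sentence_foralls (S : signature) (k : nat) (p : form S) : free_below k p -> sentence (foralls k p).
Proof. intros H v Hv. apply free_foralls in Hv as [H1 H2]. apply H in H2. lia. Qed.

Lemma holds_foralls (S : signature) (M : structure S) (k : nat) (p : form S) (a : nat -> M) :
  holds M a (foralls k p) <-> forall b, (forall v, k <= v -> b v = a v) -> holds M b p.
Proof.
  revert p. induction k as [|k IH]; simpl; intros p.
  - split; [|intros H; apply H; auto]. intros H b Hb.
    replace b with a; auto. apply functional_extensionality. intros v. symmetry. apply Hb. lia.
  - rewrite IH. split.
    + intros H b Hb. specialize (H (upd M b k (a k))). simpl in H.
      replace b with (upd M (upd M b k (a k)) k (b k)).
      * apply H. intros v Hv. unfold upd. destruct (Nat.eqb_spec v k); subst; auto. apply Hb. lia.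
      * apply functional_extensionality. intros v. unfold upd. destruct (Nat.eqb_spec v k); subst; auto.
    + intros H b Hb m. apply H. intros v Hv. unfold upd. destruct (Nat.eqb_spec v k); [lia|]. apply Hb. lia.
Qed.

Lemma models_foralls (S : signature) (M : structure S) (k : nat) (p : form S) :
  free_below k p -> (models M (foralls k p) <-> forall a, holds M a p).
Proof.
  intros Hp. unfold models. rewrite holds_foralls. split; intros H a; auto.
  rewrite (holds_ext _ M p a (fun v => if lt_dec v k then a v else inhab M)).
  - apply H. intros v Hv. destruct (lt_dec v k); auto; lia.
  - intros v Hv. apply Hp in Hv. destruct (lt_dec v k); auto; lia.
Qed.

(** * Isolated types and isomorphism of countable structures *)

Definition same_type {S : signature} (k : nat)
    (M : structure S) (a : nat -> M) (N : structure S) (b : nat -> N) : Prop :=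
  forall p, free_below k p -> (holds M a p <-> holds N b p).

(** There are countably many [k]-tuples in [M]. For each one that fails some formula true of [a],
    one such formula is chosen; the countable conjunction of the choices excludes them all. *)
Lemma type_isolated (S : signature) (M : structure S) (e : nat -> M) (k : nat) (a : nat -> M) :
  surjective e -> exists t, free_below k t /\ holds M a t /\ forall b, holds M b t -> same_type k M a M b.
Proof.
  intros He.
  destruct (infinite_list nat) as [code Hcode]; [exists (fun x => x); intros x y E; auto|].
  pose (asg := fun (l : list nat) v => e (nth v l 0)).
  (* The conjunct with index [n] deals with the tuple whose list of indices has code [n]; it is
     [ftrue] when there is nothing to exclude. *)
  destruct (choice_fun nat (form S) (fun n t => free_below k t /\ holds M a t /\ forall l, code l = n ->
      forall p, free_below k p -> holds M a p -> ~ holds M (asg l) p -> ~ holds M (asg l) t)) as [t Ht].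
  { intros n.
    destruct (classic (exists l p, code l = n /\ free_below k p /\ holds M a p /\ ~ holds M (asg l) p))
      as [(l & p & H1 & H2 & H3 & H4)|H].
    - exists p. split; auto. split; auto. intros l' E. rewrite <- E in H1. apply Hcode in H1. subst. auto.
    - exists ftrue. split; [intros v Hv; apply free_ftrue in Hv; tauto|]. split; [apply holds_ftrue|].
      intros l E p H1 H2 H3. exfalso. apply H. exists l, p. auto. }
  exists (fconj t). split; [|split].
  - intros v [n Hv]. exact (proj1 (Ht n) v Hv).
  - intros n. apply Ht.
  - intros b Hb.
    destruct (choice_fun _ _ _ He) as [idx Hidx].
    pose (l := map (fun v => idx (b v)) (seq 0 k)).
    assert (Hl : forall p, free_below k p -> (holds M (asg l) p <-> holds M b p)).
    { intros p Hp. apply holds_ext. intros v Hv. unfold asg, l.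
      rewrite nth_map_seq with (a := fun v => idx (b v)); auto. }
    destruct (Ht (code l)) as (H1 & H2 & H3).
    assert (K : forall p, free_below k p -> holds M a p -> holds M b p).
    { intros p Hp Ha. apply NNPP. intros Hn. apply (H3 l eq_refl p); auto.
      - rewrite Hl; auto.
      - rewrite Hl; auto. }
    intros p Hp. split; [auto|]. intros H. apply NNPP. intros Hn.
    apply (K (fneg p)) in Hn; auto.
Qed.

(** Let [t] isolate the type of [a] extended by [m]. That some element satisfies [t] is part of the
    type of [a], which yields [n]. For each [p] in the extended type, the closed sentence saying
    that [t] implies [p] holds in [M], hence in [N], so [n] inherits [p]. *)
Lemma same_type_extend (S : signature) (M N : structure S) (e : nat -> M) (k : nat)
    (a : nat -> M) (b : nat -> N) (m : M) :
  surjective e -> same_type k M a N b ->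
  exists n, same_type (Datatypes.S k) M (upd M a k m) N (upd N b k n).
Proof.
  intros He H. destruct (type_isolated S M e (Datatypes.S k) (upd M a k m) He) as (t & T1 & T2 & T3).
  assert (Hex : holds N b (fex k t)).
  { apply H; [|exists m; auto]. intros v [Hv1 Hv2]. apply T1 in Hv2. lia. }
  destruct Hex as [n Hn]. exists n.
  assert (K : forall p, free_below (Datatypes.S k) p -> holds M (upd M a k m) p -> holds N (upd N b k n) p).
  { intros p Hp Hm.
    assert (Hf : free_below (Datatypes.S k) (fimp t p)).
    { intros v Hv. apply free_fimp in Hv as [Hv|Hv]; auto. }
    assert (HM : holds M a (foralls (Datatypes.S k) (fimp t p))).
    { apply (sentence_holds _ M _ a (sentence_foralls _ _ _ Hf)), models_foralls; auto.
      intros c. apply holds_fimp. intros Hc. apply T3 in Hc. apply Hc; auto. }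
    apply H in HM.
    - apply (sentence_holds _ N _ b (sentence_foralls _ _ _ Hf)) in HM.
      rewrite models_foralls in HM by auto. specialize (HM (upd N b k n)). rewrite holds_fimp in HM. auto.
    - intros v Hv. destruct (sentence_foralls _ _ _ Hf v Hv). }
  intros p Hp. split; [apply K; auto|]. intros G. apply NNPP. intros Hn'.
  apply (K (fneg p)) in Hn'; auto.
Qed.

Lemma same_type_sym (S : signature) (M N : structure S) k a b : same_type k M a N b -> same_type k N b M a.
Proof. intros H p Hp. symmetry. auto. Qed.

(** The head of the list gets the highest index, so that a new element does not renumber the old
    ones. *)
Fixpoint listing {S : signature} (M : structure S) (l : list M) : nat -> M :=
  match l with [] => fun _ => inhab M | m :: l => upd M (listing M l) (length l) m end.

(** Scott's theorem in the form that countable structures with the same sentences are isomorphic.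
    The good lists are pairs of tuples of the same type, and each clause of [isomorphism] is the
    transfer of one atomic formula. *)
Theorem countable_isomorphism (S : signature) (M N : structure S) (u : nat -> M) (w : nat -> N) :
  surjective u -> surjective w -> (forall p, sentence p -> (models M p <-> models N p)) ->
  exists R : M -> N -> Prop, isomorphism R.
Proof.
  intros Hu Hw H.
  pose (G := fun l : list (M * N) =>
    same_type (length l) M (listing M (map fst l)) N (listing N (map snd l))).
  destruct (back_and_forth M N u w G Hu Hw) as (R & R1 & R2 & R3).
  - intros p Hp. apply H. intros v Hv. apply Hp in Hv. simpl in Hv. lia.
  - intros l x Gl. destruct (same_type_extend S M N u _ _ _ x Hu Gl) as [y Hy].
    exists y. unfold G. simpl. rewrite !length_map. auto.
  - intros l y Gl. destruct (same_type_extend S N M w _ _ _ y Hw (same_type_sym _ _ _ _ _ _ Gl)) as [x Hx].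
    exists x. unfold G. simpl. rewrite !length_map. apply same_type_sym. auto.
  (* The position of a pair in a good list serves as the variable that denotes it on both sides. *)
  - assert (pos : forall l x y, In (x, y) l -> exists v, v < length l /\
       listing M (map fst l) v = x /\ listing N (map snd l) v = y).
    { induction l as [|[x' y'] l IH]; intros x y []; simpl; unfold upd; rewrite !length_map.
      - injection H0 as -> ->. exists (length l). rewrite Nat.eqb_refl. auto.
      - destruct (IH x y H0) as (v & Hv & E). exists v. rewrite (proj2 (Nat.eqb_neq v (length l))); auto; lia. }
    (* All arguments of a symbol, together with [l0], are found in a single good list, so that one
       formula can speak of them. *)
    assert (fam : forall k (a : Fin.t k -> M) (b : Fin.t k -> N), (forall i, R (a i) (b i)) ->
      forall l0, (forall x y, In (x, y) l0 -> R x y) ->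
      exists l, G l /\ incl l0 l /\ exists v : Fin.t k -> nat, forall i, v i < length l /\
        listing M (map fst l) (v i) = a i /\ listing N (map snd l) (v i) = b i).
    { intros k a b Hab l0 Hl0.
      pose (L := map (fun n => extend None (fun i => Some (a i, b i)) n) (seq 0 k)).
      destruct (R3 (l0 ++ flat_map (fun o => match o with Some p => [p] | None => [] end) L)) as (l & Gl & Hl).
      - intros x y Hxy. apply in_app_iff in Hxy as [Hxy|Hxy]; auto.
        apply in_flat_map in Hxy as (o & Ho & Hxy). apply in_map_iff in Ho as (n & <- & _).
        unfold extend in Hxy. destruct (lt_dec n k); [|destruct Hxy].
        destruct Hxy as [E|[]]. injection E as <- <-. auto.
      - exists l. split; auto. split; [intros p Hp; apply Hl, in_app_iff; auto|].
        apply (choice_fun (Fin.t k) nat (fun i v => v < length l /\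
          listing M (map fst l) v = a i /\ listing N (map snd l) v = b i)).
        intros i. apply pos, Hl, in_app_iff. right. apply in_flat_map. exists (Some (a i, b i)).
        split; [|simpl; auto]. apply in_map_iff. exists (ordinal i). 
        split; [apply (extend_ordinal k _ None (fun i => Some (a i, b i)))|].
        apply in_seq. pose proof (ordinal_lt _ i). lia. }
    exists R. split; [auto|]. split; [auto|]. split; [|split].
    + intros x y x' y' Hxy Hxy'.
      destruct (R3 [(x, y); (x', y')]) as (l & Gl & Hl).
      { intros ? ? [E|[E|[]]]; injection E as <- <-; auto. }
      destruct (pos l x y) as (v & Hv & <- & <-); [apply Hl; simpl; auto|].
      destruct (pos l x' y') as (v' & Hv' & <- & <-); [apply Hl; simpl; auto|].
      apply (Gl (feq (tvar S v) (tvar S v'))). intros z [<-|<-]; auto.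
    + intros r a b Hab. destruct (fam _ a b Hab []) as (l & Gl & _ & v & Hv); [intros ? ? []|].
      replace a with (fun i => listing M (map fst l) (v i))
        by (apply functional_extensionality; intros i; apply Hv).
      replace b with (fun i => listing N (map snd l) (v i))
        by (apply functional_extensionality; intros i; apply Hv).
      apply (Gl (frel r (fun i => tvar S (v i)))). intros z [i <-]. apply Hv.
    (* The value of [f] in [M] is put into the same list as the arguments; the equation defining it
       then carries over to [N]. *)
    + intros f a b Hab. destruct (R1 (fn_int M f a)) as [y Hy].
      destruct (fam _ a b Hab [(fn_int M f a, y)]) as (l & Gl & Hl & v & Hv).
      { intros ? ? [E|[]]. injection E as <- <-. auto. }
      destruct (pos l (fn_int M f a) y) as (z & Hz & E1 & E2); [apply Hl; simpl; auto|].
      assert (E : holds N (listing N (map snd l)) (feq (tapp f (fun i => tvar S (v i))) (tvar S z))).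
      { apply Gl.
        - intros x [[i <-]|<-]; auto. apply Hv.
        - simpl. rewrite E1. f_equal. apply functional_extensionality. intros i. apply Hv. }
      simpl in E. replace (fun i => listing N (map snd l) (v i)) with b in E
        by (symmetry; apply functional_extensionality; intros i; apply Hv).
      rewrite E, E2. auto.
Qed.

Lemma complete_equivalent (S : signature) (p q : form S) (M N : structure S) :
  complete p -> models M p -> models N p -> sentence q -> (models M q <-> models N q).
Proof.
  intros Hp HM HN Hq. destruct (Hp q Hq) as [H|H]; [split; auto|].
  split; intros G; [destruct (H M HM G)|destruct (H N HN G)].
Qed.

(** For any isomorphism [R0], following [G] by the inverse of [R0] permutes the set [P] of [M]. An
    automorphism [h] extends this permutation, and [h] followed by [R0] agrees with [G] on [P]. *)
Lemma isomorphism_extending (S : signature) (p : form S) (P : Rel S) (M N : structure S) (G : M -> N -> Prop) :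
  complete p -> models M p -> models N p -> same_card M nat -> same_card N nat ->
  completely_homogeneous M P ->
  (forall x, Pset M P x -> exists y, Pset N P y /\ G x y) ->
  (forall y, Pset N P y -> exists x, Pset M P x /\ G x y) ->
  (forall x y x' y', G x y -> G x' y' -> (x = x' <-> y = y')) ->
  exists R : M -> N -> Prop, isomorphism R /\ forall x y, Pset M P x -> G x y -> R x y.
Proof.
  intros Hp HM HN CM CN [_ Hhom] G1 G2 G3.
  assert (enum : forall A : Type, same_card A nat -> exists u : nat -> A, surjective u).
  { intros A (f & Hi & Hs). destruct (choice_fun _ _ _ Hs) as [u Hu]. exists u. intros x. exists (f x). auto. }
  destruct (enum _ CM) as [u Hu], (enum _ CN) as [w Hw].
  destruct (countable_isomorphism S M N u w Hu Hw) as [R0 HR0].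
  { intros q Hq. eapply complete_equivalent; eauto. }
  pose proof HR0 as (A1 & A2 & A3 & A4 & A5).
  assert (RP : forall x y, R0 x y -> (Pset M P x <-> Pset N P y)).
  { intros x y Hxy. apply A4. auto. }
  destruct (choice_fun {x | Pset M P x} {x | Pset M P x}
    (fun x z => exists y, G (proj1_sig x) y /\ R0 (proj1_sig z) y)) as [g Hg].
  { intros [x Hx]. destruct (G1 x Hx) as (y & Hy & Gy). destruct (A2 y) as [z Hz].
    exists (exist _ z (proj2 (RP z y Hz) Hy)). simpl. eauto. }
  destruct (Hhom g) as (h & (Hb & Hr & Hf) & Hh).
  { split.
    - intros x x' E. destruct (Hg x) as (y & Gy & Ry), (Hg x') as (y' & Gy' & Ry').
      rewrite E in Ry. apply proj1_sig_inj, (G3 _ _ _ _ Gy Gy'), (A3 _ _ _ _ Ry Ry'). auto.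
    - intros [z Hz]. destruct (A1 z) as [y Hy].
      destruct (G2 y) as (x & Hx & Gx); [apply (RP z y); auto|].
      exists (exist _ x Hx). destruct (Hg (exist _ x Hx)) as (y' & Gy' & Ry'). simpl in *.
      apply proj1_sig_inj. simpl. apply (A3 _ _ _ _ Ry' Hy), (G3 _ _ _ _ Gy' Gx). auto. }
  exists (fun x y => R0 (h x) y). split.
  - split; [|split; [|split; [|split]]].
    + intros x. apply A1.
    + intros y. destruct (A2 y) as [z Hz]. destruct (proj2 Hb z) as [x <-]. eauto.
    + intros x y x' y' H H'. rewrite <- (A3 _ _ _ _ H H'). split; [congruence|]. apply Hb.
    + intros r a b Hab. rewrite Hr. apply A4. auto.
    + intros f a b Hab. rewrite Hf. apply A5. auto.
  - intros x y Hx Hxy. rewrite (Hh x Hx). destruct (Hg (exist _ x Hx)) as (y' & Gy' & Ry'). simpl in Gy'.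
    replace y with y'; auto. apply (G3 _ _ _ _ Gy' Hxy). auto.
Qed.

(** * Tree-like structures *)

Inductive tree_rel (S : signature) : Type :=
| sort : nat -> tree_rel S
| lift_rel : nat -> Rel S -> tree_rel S.

(** Functions are total, so [star] names one extra element, neither in a sort nor a branch, which is
    the value wherever [proj] and [lift_fn] have no meaning. *)
Inductive tree_fn (S : signature) : Type :=
| star : tree_fn S
| proj : nat -> tree_fn S
| lift_fn : nat -> Fn S -> tree_fn S.

Arguments sort {S} n.
Arguments lift_rel {S} n r.
Arguments star {S}.
Arguments proj {S} n.
Arguments lift_fn {S} n f.

Definition tree_rel_ar {S : signature} (r : tree_rel S) : nat :=
  match r with sort _ => 1 | lift_rel _ r => rel_ar S r end.

Definition tree_fn_ar {S : signature} (f : tree_fn S) : nat :=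
  match f with star => 0 | proj _ => 1 | lift_fn _ f => fn_ar S f end.

Lemma to_nat_inj (p q : nat * nat) : to_nat p = to_nat q -> p = q.
Proof. intros E. rewrite <- (cancel_of_to p), E. apply cancel_of_to. Qed.

Lemma tree_rel_countable (S : signature) : exists c : tree_rel S -> nat, injective c.
Proof.
  destruct (rel_countable S) as [c Hc].
  exists (fun r => match r with sort n => to_nat (n, 0) | lift_rel n r => to_nat (n, Datatypes.S (c r)) end).
  intros [n|n r] [m|m s] E; apply to_nat_inj, pair_equal_spec in E as [E1 E2];
    try discriminate E2; subst; auto.
  injection E2 as E2. apply Hc in E2 as ->. reflexivity.
Qed.

Lemma tree_fn_countable (S : signature) : exists c : tree_fn S -> nat, injective c.
Proof.
  destruct (fn_countable S) as [c Hc].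
  exists (fun f => match f with star => to_nat (0, 0) | proj n => to_nat (n, 1)
    | lift_fn n f => to_nat (n, Datatypes.S (Datatypes.S (c f))) end).
  intros [|n|n f] [|m|m g] E; apply to_nat_inj, pair_equal_spec in E as [E1 E2];
    try discriminate E2; subst; auto.
  injection E2 as E2. apply Hc in E2 as ->. reflexivity.
Qed.

Definition tree_sig (S : signature) : signature :=
  Build_signature (@tree_rel_ar S) (@tree_fn_ar S) (tree_rel_countable S) (tree_fn_countable S).

Notation rel_in M n r := (rel_int M (lift_rel n r : Rel (tree_sig _))).
Notation fn_in M n f := (fn_int M (lift_fn n f : Fn (tree_sig _))).

Definition in_sort {S : signature} (M : structure (tree_sig S)) (n : nat) (x : M) : Prop :=
  rel_int M (sort n : Rel (tree_sig S)) (fun _ => x).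

Definition junk {S : signature} (M : structure (tree_sig S)) : M :=
  fn_int M (star : Fn (tree_sig S)) (fun _ => inhab M).

Definition pr {S : signature} (M : structure (tree_sig S)) (n : nat) (x : M) : M :=
  fn_int M (proj n : Fn (tree_sig S)) (fun _ => x).

Definition branch {S : signature} (M : structure (tree_sig S)) (x : M) : Prop :=
  x <> junk M /\ forall n, ~ in_sort M n x.

Definition node {S : signature} (P : Rel S) (M : structure (tree_sig S)) (n : nat) (x : M) : Prop :=
  rel_in M n P (fun _ => x).

Fixpoint lift_term {S : signature} (n : nat) (t : term S) : term (tree_sig S) :=
  match t with
  | @tvar _ v => tvar (tree_sig S) v
  | tapp f args => tapp (lift_fn n f : Fn (tree_sig S)) (fun i => lift_term n (args i))
  end.

Definition fsort {S : signature} (n : nat) (t : term (tree_sig S)) : form (tree_sig S) :=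
  frel (sort n : Rel (tree_sig S)) (fun _ => t).

Fixpoint relativize {S : signature} (n : nat) (p : form S) : form (tree_sig S) :=
  match p with
  | feq t1 t2 => feq (lift_term n t1) (lift_term n t2)
  | frel r args => frel (lift_rel n r : Rel (tree_sig S)) (fun i => lift_term n (args i))
  | fneg p => fneg (relativize n p)
  | fconj ps => fconj (fun m => relativize n (ps m))
  | fdisj ps => fdisj (fun m => relativize n (ps m))
  | fex x p => fex x (fand (fsort n (tvar (tree_sig S) x)) (relativize n p))
  | fall x p => fall x (fimp (fsort n (tvar (tree_sig S) x)) (relativize n p))
  end.

Lemma tfree_lift_term (S : signature) (n : nat) (t : term S) (v : nat) : tfree (lift_term n t) v -> tfree t v.
Proof. induction t as [|f args IH]; simpl; auto. intros [i H]. eauto. Qed.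

Lemma free_relativize (S : signature) (n : nat) (p : form S) (v : nat) : free (relativize n p) v -> free p v.
Proof.
  induction p as [t1 t2|r args|p IH|ps IH|ps IH|x p IH|x p IH]; cbn -[fand fimp]; auto.
  - intros [H|H]; apply tfree_lift_term in H; auto.
  - intros [i H]; apply tfree_lift_term in H; eauto.
  - intros [m H]; eauto.
  - intros [m H]; eauto.
  - intros [H1 H2]. apply free_fand in H2 as [[_ H2]|H2]; [destruct (H1 H2)|auto].
  - intros [H1 H2]. apply free_fimp in H2 as [[_ H2]|H2]; [destruct (H1 H2)|auto].
Qed.

Lemma sentence_relativize (S : signature) (n : nat) (p : form S) : sentence p -> sentence (relativize n p).
Proof. intros H v Hv. eapply H, free_relativize; eauto. Qed.

(* [j] identifies the [S]-structure [A] with the [n]-th sort of [M]. *)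
Definition copy {S : signature} {A : structure S} {M : structure (tree_sig S)} (n : nat) (j : A -> M) : Prop :=
  injective j /\ (forall x, in_sort M n x <-> exists y, j y = x) /\
  (forall r args, rel_int A r args <-> rel_in M n r (fun i => j (args i))) /\
  (forall f args, j (fn_int A f args) = fn_in M n f (fun i => j (args i))).

Lemma copy_holds (S : signature) (A : structure S) (M : structure (tree_sig S)) (n : nat) (j : A -> M)
    (p : form S) :
  copy n j -> forall a, holds M (fun v => j (a v)) (relativize n p) <-> holds A a p.
Proof.
  intros (J1 & J2 & J3 & J4).
  assert (Ht : forall a t, teval M (fun v => j (a v)) (lift_term n t) = j (teval A a t)).
  { intros a t. induction t as [v|f args IH]; simpl; auto. rewrite J4. f_equal.
    apply functional_extensionality. auto. }
  assert (Hu : forall a x m, upd M (fun v => j (a v)) x (j m) = fun v => j (upd A a x m v)).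
  { intros a x m. apply functional_extensionality. intros v. unfold upd. destruct (Nat.eqb v x); auto. }
  assert (Hs : forall a x m, holds M (upd M a x m) (fsort n (tvar (tree_sig S) x)) <-> exists y, j y = m).
  { intros a x m. rewrite <- J2. simpl. unfold upd. rewrite Nat.eqb_refl. unfold in_sort. tauto. }
  induction p as [t1 t2|r args|p IH|ps IH|ps IH|x p IH|x p IH]; cbn -[fand fimp fsort]; intros a.
  - rewrite !Ht. split; [apply J1|congruence].
  - rewrite J3. replace (fun i => teval M (fun v => j (a v)) (lift_term n (args i)))
      with (fun i => j (teval A a (args i))); [tauto|].
    apply functional_extensionality. intros i. symmetry. apply Ht.
  - rewrite IH. tauto.
  - split; intros H m; apply (IH m a); auto.
  - split; intros [m H]; exists m; apply (IH m a); auto.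
  - split.
    + intros [m H]. apply holds_fand in H as [H1 H2]. apply Hs in H1 as [y <-].
      exists y. rewrite Hu in H2. apply IH. auto.
    + intros [y H]. exists (j y). apply holds_fand. split; [apply Hs; eauto|]. rewrite Hu. apply IH. auto.
  - split.
    + intros H y. specialize (H (j y)). rewrite holds_fimp, Hu, IH in H. apply H. rewrite <- Hu. apply Hs. eauto.
    + intros H m. apply holds_fimp. intros Hm. apply Hs in Hm as [y <-]. rewrite Hu. apply IH. auto.
Qed.

Lemma copy_models (S : signature) (A : structure S) (M : structure (tree_sig S)) (n : nat) (j : A -> M)
    (p : form S) :
  copy n j -> sentence p -> (models M (relativize n p) <-> models A p).
Proof.
  intros Hj Hp. rewrite <- (sentence_holds _ M _ (fun _ => j (inhab A)) (sentence_relativize _ n _ Hp)).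
  apply copy_holds with (a := fun _ => inhab A); auto.
Qed.

(** [pr_splits] combines infinite splitting with density: some branch follows [a k] below level [n]
    and at level [n] avoids the nodes of the finitely many listed [a i]. For [n = 0] it says that
    level 0 is infinite. The listed elements need not be branches. *)
Record tree_like {S : signature} (p : form S) (P : Rel S) (M : structure (tree_sig S)) : Prop := {
  sort_disjoint : forall n m x, in_sort M n x -> in_sort M m x -> n = m;
  sort_junk : forall n, ~ in_sort M n (junk M);
  sort_inhabited : forall n, exists x, in_sort M n x;
  sort_models : forall n, models M (relativize n p);
  lift_fn_closed : forall n f args, (forall i, in_sort M n (args i)) ->
    in_sort M n (fn_in M n f args);
  lift_fn_junk : forall n f args, ~ (forall i, in_sort M n (args i)) ->
    fn_in M n f args = junk M;
  lift_rel_sort : forall n r args, rel_in M n r args -> forall i, in_sort M n (args i);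
  branch_inhabited : exists b, branch M b;
  pr_node : forall n b, branch M b -> node P M n (pr M n b);
  pr_junk : forall n x, ~ branch M x -> pr M n x = junk M;
  pr_surjective : forall n x, node P M n x -> exists b, branch M b /\ pr M n b = x;
  pr_refines : forall n b c, branch M b -> branch M c ->
    pr M (Datatypes.S n) b = pr M (Datatypes.S n) c -> pr M n b = pr M n c;
  pr_separates : forall b c, branch M b -> branch M c -> (forall n, pr M n b = pr M n c) -> b = c;
  pr_splits : forall n k (a : nat -> M), branch M (a k) -> exists c, branch M c /\
    (forall m, m < n -> pr M m c = pr M m (a k)) /\ (forall i, i < k -> pr M n c <> pr M n (a i)) }.

(** * Matching the branches of countable tree-like structures *)

Lemma pr_mono (S : signature) (p : form S) (P : Rel S) (M : structure (tree_sig S)) (m n : nat) (b c : M) :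
  tree_like p P M -> m <= n -> branch M b -> branch M c -> pr M n b = pr M n c -> pr M m b = pr M m c.
Proof. intros H L Hb Hc. induction L; auto. intros E. apply IHL. eapply pr_refines; eauto. Qed.

Lemma sort_copy (S : signature) (p : form S) (P : Rel S) (M : structure (tree_sig S)) (n : nat) :
  tree_like p P M -> exists (A : structure S) (j : A -> M), copy n j.
Proof.
  intros H. destruct (constructive_indefinite_description _ (sort_inhabited _ _ _ H n)) as [x0 Hx0].
  exists (@Build_structure S {x | in_sort M n x} (exist _ x0 Hx0)
    (fun r args => rel_in M n r (fun i => proj1_sig (args i)))
    (fun f args => exist _ _ (lift_fn_closed _ _ _ H n f _ (fun i => proj2_sig (args i))))).
  exists (@proj1_sig M (in_sort M n)). split; [|split; [|split]]; simpl; try tauto.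
  - intros a b. apply proj1_sig_inj.
  - intros x. split; [|intros [y <-]; apply proj2_sig]. intros Hx. exists (exist _ x Hx). auto.
Qed.

Lemma tree_like_infinite (S : signature) (p : form S) (P : Rel S) (M : structure (tree_sig S)) :
  tree_like p P M -> infinite_type M.
Proof.
  intros H. destruct (choice_fun _ _ _ (sort_inhabited _ _ _ H)) as [f Hf]. exists f. intros n m E.
  apply (sort_disjoint _ _ _ H n m (f n)); auto. rewrite E. auto.
Qed.

(* If [b] leaves the finite set of branches [l] at level [n0], then [c] has to leave the
   corresponding set at level [n0], next to the partner of a branch that follows [b] below [n0]. *)
Lemma branch_extension (S : signature) (p : form S) (P : Rel S) (M N : structure (tree_sig S))
    (l : list (M * N)) (b : M) :
  tree_like p P M -> tree_like p P N -> branch M b ->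
  (forall x y, In (x, y) l -> branch M x /\ branch N y) ->
  (forall x y x' y' n, In (x, y) l -> In (x', y') l -> (pr M n x = pr M n x' <-> pr N n y = pr N n y')) ->
  exists c, branch N c /\ forall x y n, In (x, y) l -> (pr M n b = pr M n x <-> pr N n c = pr N n y).
Proof.
  intros HM HN Hb Hl G.
  destruct (classic (exists c, In (b, c) l)) as [[c Hc]|Hnew].
  { exists c. split; [apply (Hl b c Hc)|]. intros x y n Hxy. apply G; auto. }
  (* By [pr_separates], [b] leaves each listed branch at some level and never returns; the maximum
     of these levels works for all. *)
  assert (Hex : exists n, forall x y, In (x, y) l -> pr M n b <> pr M n x).
  { cut (forall l', incl l' l -> exists n, forall x y, In (x, y) l' -> pr M n b <> pr M n x).
    { intros K. apply K, incl_refl. }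
    induction l' as [|[x y] l' IH]; intros Hi; [exists 0; intros x y []|].
    destruct IH as [n Hn]; [intros z Hz; apply Hi; simpl; auto|].
    assert (Hxy : In (x, y) l) by (apply Hi; simpl; auto).
    assert (Hm : exists m, pr M m b <> pr M m x).
    { apply not_all_ex_not. intros E.
      apply (pr_separates _ _ _ HM) in E; auto; [subst; eauto|apply (Hl x y); auto]. }
    destruct Hm as [m Hm]. exists (Nat.max n m). intros x' y' H E.
    assert (Hxy' : In (x', y') l) by (apply Hi; auto).
    destruct H as [H|H].
    - injection H as -> ->. apply Hm. eapply pr_mono; [eauto| |auto|apply (Hl x' y'); auto|exact E]. lia.
    - apply (Hn x' y' H). eapply pr_mono; [eauto| |auto|apply (Hl x' y'); auto|exact E]. lia. }
  assert (Hmin : exists n0, (forall x y, In (x, y) l -> pr M n0 b <> pr M n0 x) /\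
     forall m, m < n0 -> exists x y, In (x, y) l /\ pr M m b = pr M m x).
  { destruct Hex as [n Hn]. induction n as [n IH] using lt_wf_ind.
    destruct (classic (exists m, m < n /\ forall x y, In (x, y) l -> pr M m b <> pr M m x))
      as [(m & Hm & Hm')|H].
    - apply (IH m); auto.
    - exists n. split; auto. intros m Hm. apply NNPP. intros K. apply H. exists m. split; auto.
      intros x y Hxy E. apply K. eauto. }
  destruct Hmin as (n0 & Hn0 & Hlow).
  assert (Hc0 : exists c0, branch N c0 /\ forall m, m < n0 -> exists b0, In (b0, c0) l /\ pr M m b = pr M m b0).
  { destruct n0 as [|n].
    - destruct (branch_inhabited _ _ _ HN) as [c0 Hc0]. exists c0. split; auto. intros; lia.
    - destruct (Hlow n) as (x & y & Hxy & E); auto. exists y. split; [apply (Hl x y); auto|].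
      intros m Hm. exists x. split; auto. eapply pr_mono; [eauto| |auto|apply (Hl x y); auto|exact E]. lia. }
  destruct Hc0 as (c0 & Bc0 & Hc0).
  (* The default of [nth] plays a role: at index [length l] it gives [c0], the branch to follow,
     while the indices below give the partners to avoid. *)
  destruct (pr_splits _ _ _ HN n0 (length l) (fun i => nth i (map snd l) c0)) as (c & Bc & C1 & C2).
  { rewrite nth_overflow; auto. rewrite length_map. auto. }
  exists c. split; auto. rewrite nth_overflow in C1 by (rewrite length_map; auto).
  intros x y n Hxy. destruct (Hl x y Hxy) as [Bx By]. destruct (le_lt_dec n0 n) as [H|H].
  - split; intros E; exfalso.
    + apply (Hn0 x y Hxy). apply (pr_mono _ _ _ _ n0 n _ _ HM); auto.
    + apply (in_map snd) in Hxy. apply In_nth with (d := c0) in Hxy as (i & Hi & Ei). simpl in Ei.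
      rewrite length_map in Hi. apply (C2 i Hi). rewrite Ei. apply (pr_mono _ _ _ _ n0 n _ _ HN); auto.
  - destruct (Hc0 n H) as (b0 & Hb0 & E). rewrite E, (C1 n H). apply G; auto.
Qed.

(** A list is good if on both sides the same pairs of branches share a node, at every level. The
    condition is symmetric, so one extension lemma serves both directions. *)
Lemma branch_back_and_forth (S : signature) (p : form S) (P : Rel S) (M N : structure (tree_sig S)) :
  tree_like p P M -> tree_like p P N -> same_card M nat -> same_card N nat ->
  exists R : M -> N -> Prop, (forall x y, R x y -> branch M x /\ branch N y) /\
    (forall x, branch M x -> exists y, R x y) /\ (forall y, branch N y -> exists x, R x y) /\
    (forall x y x' y' n, R x y -> R x' y' -> (pr M n x = pr M n x' <-> pr N n y = pr N n y')).
Proof.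
  intros HM HN CM CN.
  assert (enum : forall M, tree_like p P M -> same_card M nat ->
      exists u : nat -> {x | branch M x}, surjective u).
  { intros K HK (f & Hi & Hs). destruct (branch_inhabited _ _ _ HK) as [b0 Hb0].
    destruct (choice_fun nat {x | branch K x} (fun n x => forall y, f (proj1_sig y) = n -> x = y)) as [u Hu].
    - intros n. destruct (classic (exists y : {x | branch K x}, f (proj1_sig y) = n)) as [[y <-]|H].
      + exists y. intros y' E. apply proj1_sig_inj, Hi. auto.
      + exists (exist _ b0 Hb0). intros y E. exfalso. eauto.
    - exists u. intros y. exists (f (proj1_sig y)). apply Hu. auto. }
  destruct (enum M HM CM) as [u Hu], (enum N HN CN) as [w Hw].
  pose (G := fun l : list ({x | branch M x} * {y | branch N y}) => forall x y x' y' n,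
    In (x, y) l -> In (x', y') l ->
    (pr M n (proj1_sig x) = pr M n (proj1_sig x') <-> pr N n (proj1_sig y) = pr N n (proj1_sig y'))).
  assert (Gcons : forall l x y, G l -> (forall x' y' n, In (x', y') l ->
      (pr M n (proj1_sig x) = pr M n (proj1_sig x') <-> pr N n (proj1_sig y) = pr N n (proj1_sig y'))) ->
      G ((x, y) :: l)).
  { intros l x y Gl H x1 y1 x2 y2 n [E1|H1] [E2|H2]; try (injection E1 as <- <-); try (injection E2 as <- <-).
    - tauto.
    - auto.
    - specialize (H x1 y1 n H1). split; intros E; symmetry; apply H; auto.
    - apply Gl; auto. }
  destruct (back_and_forth _ _ u w G Hu Hw) as (R & R1 & R2 & R3).
  - intros ? ? ? ? ? [].
  - intros l [x Hx] Gl.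
    destruct (branch_extension S p P M N (map (fun q => (proj1_sig (fst q), proj1_sig (snd q))) l) x)
      as (c & Bc & Hc); auto.
    + intros a b H. apply in_map_iff in H as ([a' b'] & E & _). injection E as <- <-. split; apply proj2_sig.
    + intros a b a' b' n H H'. apply in_map_iff in H as ([a1 b1] & E & H). injection E as <- <-.
      apply in_map_iff in H' as ([a2 b2] & E & H'). injection E as <- <-. apply Gl; auto.
    + exists (exist _ c Bc). apply Gcons; auto. intros x' y' n H. simpl. apply Hc.
      apply in_map_iff. exists (x', y'). auto.
  - intros l [y Hy] Gl.
    destruct (branch_extension S p P N M (map (fun q => (proj1_sig (snd q), proj1_sig (fst q))) l) y)
      as (c & Bc & Hc); auto.
    + intros a b H. apply in_map_iff in H as ([a' b'] & E & _). injection E as <- <-. split; apply proj2_sig.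
    + intros a b a' b' n H H'. apply in_map_iff in H as ([a1 b1] & E & H). injection E as <- <-.
      apply in_map_iff in H' as ([a2 b2] & E & H'). injection E as <- <-. symmetry. apply Gl; auto.
    + exists (exist _ c Bc). apply Gcons; auto. intros x' y' n H. simpl. symmetry. apply Hc.
      apply in_map_iff. exists (x', y'). auto.
  - exists (fun x y => exists x' y', R x' y' /\ proj1_sig x' = x /\ proj1_sig y' = y).
    split; [|split; [|split]].
    + intros x y (x' & y' & _ & <- & <-). split; apply proj2_sig.
    + intros x Hx. destruct (R1 (exist _ x Hx)) as [y Hy]. exists (proj1_sig y), (exist _ x Hx), y. auto.
    + intros y Hy. destruct (R2 (exist _ y Hy)) as [x Hx]. exists (proj1_sig x), x, (exist _ y Hy). auto.
    + intros ? ? ? ? n (x & y & H & <- & <-) (x' & y' & H' & <- & <-).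
      destruct (R3 [(x, y); (x', y')]) as (l & Gl & Hl).
      { intros ? ? [E|[E|[]]]; injection E as <- <-; auto. }
      apply Gl; apply Hl; simpl; auto.
Qed.

(** * Isomorphisms of the sorts and their gluing *)

Definition homogeneous_countable {S : signature} (p : form S) (P : Rel S) : Prop :=
  forall M : structure S, models M p -> same_card M nat -> completely_homogeneous M P.

Lemma copy_node (S : signature) (P : Rel S) (A : structure S) (M : structure (tree_sig S)) (n : nat)
    (j : A -> M) (x : A) :
  copy n j -> (node P M n (j x) <-> Pset A P x).
Proof. intros (_ & _ & H & _). symmetry. apply H. Qed.

Lemma node_sort (S : signature) (p : form S) (P : Rel S) (M : structure (tree_sig S)) (n : nat) (x : M) :
  tree_like p P M -> rel_ar S P = 1 -> node P M n x -> in_sort M n x.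
Proof.
  intros H HP Hx. assert (i : Fin.t (rel_ar S P)) by (rewrite HP; exact Fin.F1).
  exact (lift_rel_sort _ _ _ H n P _ Hx i).
Qed.

(** Complete homogeneity is assumed only for models of size exactly that of [nat], so a sort must be
    shown infinite. It is, because splitting provides infinitely many nodes on its level. *)
Lemma copy_countable (S : signature) (p : form S) (P : Rel S) (A : structure S)
    (M : structure (tree_sig S)) (n : nat) (j : A -> M) :
  tree_like p P M -> rel_ar S P = 1 -> same_card M nat -> copy n j -> same_card A nat.
Proof.
  intros H HP (f & Hf & _) Hj. apply cantor_bernstein.
  - exists (fun x => f (j x)). intros x y E. apply Hj, Hf. auto.
  - destruct (branch_inhabited _ _ _ H) as [b0 Hb0].
    pose (above := fun x => epsilon (inhabits b0) (fun b => branch M b /\ pr M n b = x)).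
    assert (Hnew : forall l : list A, exists x, ~ In x l).
    (* Splitting against chosen branches through the nodes in [l] yields a branch whose node of
       level [n] is not in [l]. *)
    { intros l. destruct (pr_splits _ _ _ H n (length (map j l))
        (fun i => nth i (map above (map j l)) b0))
        as (c & Bc & _ & Hc).
      { rewrite nth_overflow; auto. rewrite length_map. auto. }
      pose proof (pr_node _ _ _ H n c Bc) as Hn.
      pose proof (node_sort _ _ _ _ _ _ H HP Hn) as Hs. apply Hj in Hs as [x Hx].
      exists x. intros Hin. pose proof Hn as Hn'. rewrite <- Hx in Hn'.
      apply (pr_surjective _ _ _ H), (epsilon_spec (inhabits b0)) in Hn' as [_ He].
      change (pr M n (above (j x)) = j x) in He.
      apply (in_map j), (in_map above) in Hin.
      apply In_nth with (d := b0) in Hin as (i & Hi & Ei). rewrite length_map in Hi.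
      apply (Hc i Hi). rewrite Ei, He. auto. }
    destruct (choice_fun _ _ _ Hnew) as [new Hn].
    pose (s := nat_rect (fun _ => list A) [] (fun _ l => new l :: l)).
    assert (Hin : forall m k, m < k -> In (new (s m)) (s k)).
    { intros m k L. induction L; simpl; auto. }
    exists (fun m => new (s m)). intros m k E. destruct (lt_eq_lt_dec m k) as [[L|L]|L]; auto; exfalso.
    + apply (Hn (s k)). rewrite <- E. auto.
    + apply (Hn (s m)). rewrite E. auto.
Qed.

(** The relation lives on the whole structures and is confined to one sort by [sort_iso_domain], so
    that the levels can simply be united. *)
Record sort_isomorphism {S : signature} {M N : structure (tree_sig S)} (n : nat) (R : M -> N -> Prop) : Prop := {
  sort_iso_domain : forall x y, R x y -> in_sort M n x /\ in_sort N n y;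
  sort_iso_total : forall x, in_sort M n x -> exists y, R x y;
  sort_iso_surjective : forall y, in_sort N n y -> exists x, R x y;
  sort_iso_injective : forall x y x' y', R x y -> R x' y' -> (x = x' <-> y = y');
  sort_iso_rel : forall r a b, (forall i, R (a i) (b i)) -> (rel_in M n r a <-> rel_in N n r b);
  sort_iso_fn : forall f a b, (forall i, R (a i) (b i)) -> R (fn_in M n f a) (fn_in N n f b) }.

(** Both sorts are copies of countable models of [p]. The isomorphism extending [G] is found between
    these models and carried back along the copies. *)
Lemma sort_isomorphism_extending (S : signature) (p : form S) (P : Rel S) (M N : structure (tree_sig S))
    (n : nat) (G : M -> N -> Prop) :
  tree_like p P M -> tree_like p P N -> same_card M nat -> same_card N nat ->
  rel_ar S P = 1 -> sentence p -> complete p -> homogeneous_countable p P ->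
  (forall x, node P M n x -> exists y, node P N n y /\ G x y) ->
  (forall y, node P N n y -> exists x, node P M n x /\ G x y) ->
  (forall x y x' y', G x y -> G x' y' -> (x = x' <-> y = y')) ->
  exists R : M -> N -> Prop, sort_isomorphism n R /\
    forall x y, node P M n x -> node P N n y -> G x y -> R x y.
Proof.
  intros HM HN CM CN HP Sp Cp Hp G1 G2 G3.
  destruct (sort_copy _ _ _ _ n HM) as (A & j & Hj), (sort_copy _ _ _ _ n HN) as (B & k & Hk).
  assert (MA : models A p) by (apply (copy_models _ _ _ _ _ _ Hj Sp), (sort_models _ _ _ HM)).
  assert (MB : models B p) by (apply (copy_models _ _ _ _ _ _ Hk Sp), (sort_models _ _ _ HN)).
  pose proof (copy_countable _ _ _ _ _ _ _ HM HP CM Hj) as CA.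
  pose proof (copy_countable _ _ _ _ _ _ _ HN HP CN Hk) as CB.
  pose proof Hj as (J1 & J2 & J3 & J4). pose proof Hk as (K1 & K2 & K3 & K4).
  destruct (isomorphism_extending S p P A B (fun x y => G (j x) (k y)))
    as (R & (R1 & R2 & R3 & R4 & R5) & RG); auto.
  - intros x Hx. apply (copy_node _ _ _ _ _ _ _ Hj) in Hx. destruct (G1 _ Hx) as (y & Hy & Gy).
    pose proof (node_sort _ _ _ _ _ _ HN HP Hy) as Hs. apply K2 in Hs as [y' <-].
    exists y'. split; auto. apply (copy_node _ _ _ _ _ _ _ Hk). auto.
  - intros x Hx. apply (copy_node _ _ _ _ _ _ _ Hk) in Hx. destruct (G2 _ Hx) as (y & Hy & Gy).
    pose proof (node_sort _ _ _ _ _ _ HM HP Hy) as Hs. apply J2 in Hs as [y' <-].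
    exists y'. split; auto. apply (copy_node _ _ _ _ _ _ _ Hj). auto.
  - intros x y x' y' H H'. specialize (G3 _ _ _ _ H H'). split; intros E.
    + apply K1, G3. congruence.
    + apply J1, G3. congruence.
  - exists (fun x y => exists x' y', j x' = x /\ k y' = y /\ R x' y').
    assert (fam : forall (m : nat) (a : Fin.t m -> M) (b : Fin.t m -> N),
      (forall i, exists x' y', j x' = a i /\ k y' = b i /\ R x' y') ->
      exists a' b', (fun i => j (a' i)) = a /\ (fun i => k (b' i)) = b /\ forall i, R (a' i) (b' i)).
    { intros m a b H.
      destruct (choice_fun (Fin.t m) (A * B)
        (fun i q => j (fst q) = a i /\ k (snd q) = b i /\ R (fst q) (snd q))) as [f Hf].
      { intros i. destruct (H i) as (x & y & Hxy). exists (x, y). auto. }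
      exists (fun i => fst (f i)), (fun i => snd (f i)).
      split; [|split]; try (apply functional_extensionality); intros i; apply Hf. }
    split; [constructor|].
      * intros x y (x' & y' & <- & <- & _). split; [apply J2|apply K2]; eauto.
      * intros x Hx. apply J2 in Hx as [x' <-]. destruct (R1 x') as [y' H]. eauto 7.
      * intros y Hy. apply K2 in Hy as [y' <-]. destruct (R2 y') as [x' H]. eauto 7.
      * intros ? ? ? ? (x & y & <- & <- & H) (x' & y' & <- & <- & H'). specialize (R3 _ _ _ _ H H').
        split; intros E; f_equal; [apply J1, R3 in E|apply K1, R3 in E]; auto.
      * intros r a b H. destruct (fam _ a b H) as (a' & b' & <- & <- & H'). rewrite <- J3, <- K3. auto.
      * intros f a b H. destruct (fam _ a b H) as (a' & b' & <- & <- & H'). rewrite <- J4, <- K4. eauto 6.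
    + intros x y Hx Hy Gxy.
      pose proof (node_sort _ _ _ _ _ _ HM HP Hx) as Hsx. apply J2 in Hsx as [x' <-].
      pose proof (node_sort _ _ _ _ _ _ HN HP Hy) as Hsy. apply K2 in Hsy as [y' <-].
      exists x', y'. split; auto. split; auto. apply RG; auto. apply (copy_node _ _ _ _ _ _ _ Hj). auto.
Qed.

Lemma fin1_constant (A : Type) (f : Fin.t 1 -> A) : f = fun _ => f Fin.F1.
Proof.
  apply functional_extensionality. intros i. apply (Fin.caseS' i); auto. intros j. inversion j.
Qed.

(** The levels may be treated independently, as no symbol relates different sorts. The projections
    are respected because the isomorphism on each level extends the bijection of nodes induced by
    the branches. *)
Theorem tree_like_isomorphism (S : signature) (p : form S) (P : Rel S) (M N : structure (tree_sig S)) :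
  rel_ar S P = 1 -> sentence p -> complete p -> homogeneous_countable p P ->
  tree_like p P M -> tree_like p P N -> same_card M nat -> same_card N nat ->
  exists R : M -> N -> Prop, isomorphism R.
Proof.
  intros HP Sp Cp Hp HM HN CM CN.
  destruct (branch_back_and_forth _ _ _ _ _ HM HN CM CN) as (B & B1 & B2 & B3 & B4).
  assert (Hsort : forall n, exists R : M -> N -> Prop, sort_isomorphism n R /\
      forall b c, B b c -> R (pr M n b) (pr N n c)).
  { intros n.
    (* Nodes correspond when matched branches pass through them. Every node lies on a branch, and
       matched branches share nodes on the same levels, so this is a bijection. *)
    destruct (sort_isomorphism_extending S p P M N n
      (fun x y => exists b c, B b c /\ pr M n b = x /\ pr N n c = y)) as (R & HR & RG); auto.
    - intros x Hx. destruct (pr_surjective _ _ _ HM n x Hx) as (b & Bb & <-). destruct (B2 b Bb) as [c Hc].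
      exists (pr N n c). split; eauto. apply (pr_node _ _ _ HN), (B1 b c Hc).
    - intros y Hy. destruct (pr_surjective _ _ _ HN n y Hy) as (c & Bc & <-). destruct (B3 c Bc) as [b Hb].
      exists (pr M n b). split; eauto. apply (pr_node _ _ _ HM), (B1 b c Hb).
    - intros ? ? ? ? (b & c & H & <- & <-) (b' & c' & H' & <- & <-). auto.
    - exists R. split; auto. intros b c Hbc. destruct (B1 b c Hbc). apply RG; eauto using pr_node. }
  destruct (choice_fun _ _ _ Hsort) as [R HRB].
  pose proof (fun n => proj1 (HRB n)) as HR. pose proof (fun n => proj2 (HRB n)) as HB. clear HRB.
  (* Junk, sorts and branches partition both structures, and [H] respects the partition; the facts
     that follow recover the piece of [H] from the place of [x]. *)
  pose (H := fun x y => (x = junk M /\ y = junk N) \/ (exists n, R n x y) \/ B x y).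
  assert (Hs : forall n x y, H x y -> (in_sort M n x <-> in_sort N n y)).
  { intros n x y [[-> ->]|[[m Hm]|Hb]].
    - pose proof (sort_junk _ _ _ HM n). pose proof (sort_junk _ _ _ HN n). tauto.
    - apply (sort_iso_domain _ _ (HR m)) in Hm as [Hx Hy]. split; intros K.
      + rewrite (sort_disjoint _ _ _ HM _ _ _ K Hx). auto.
      + rewrite (sort_disjoint _ _ _ HN _ _ _ K Hy). auto.
    - apply B1 in Hb as [[_ Hx] [_ Hy]]. specialize (Hx n). specialize (Hy n). tauto. }
  assert (Hin : forall n x y, H x y -> in_sort M n x -> R n x y).
  { intros n x y [[-> ->]|[[m Hm]|Hb]] K.
    - destruct (sort_junk _ _ _ HM n K).
    - pose proof (sort_iso_domain _ _ (HR m) _ _ Hm) as [Hx _]. rewrite (sort_disjoint _ _ _ HM _ _ _ K Hx). auto.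
    - apply B1 in Hb as [[_ Hx] _]. destruct (Hx n K). }
  assert (Hj : forall x y, H x y -> (x = junk M <-> y = junk N)).
  { intros x y [[-> ->]|[[m Hm]|Hb]]; [tauto| |].
    - apply (sort_iso_domain _ _ (HR m)) in Hm as [Hx Hy].
      split; intros ->; [destruct (sort_junk _ _ _ HM m Hx)|destruct (sort_junk _ _ _ HN m Hy)].
    - apply B1 in Hb as [[Hx _] [Hy _]]. tauto. }
  assert (Hbr : forall x y, H x y -> branch M x -> B x y).
  { intros x y [[-> ->]|[[m Hm]|Hb]] [K1 K2]; [tauto| |auto].
    apply (sort_iso_domain _ _ (HR m)) in Hm as [Hx Hy]. destruct (K2 m Hx). }
  assert (Hbr' : forall x y, H x y -> (branch M x <-> branch N y)).
  { intros x y Hxy. unfold branch. rewrite (Hj x y Hxy). split; intros [K1 K2]; split; auto; intros n;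
    specialize (K2 n); rewrite (Hs n x y Hxy) in *; auto. }
  exists H. split; [|split; [|split; [|split]]].
  - intros x. destruct (classic (branch M x)) as [Hx|Hx].
    { destruct (B2 x Hx) as [y Hy]. exists y. right. right. auto. }
    destruct (classic (x = junk M)) as [->|Hx'].
    { exists (junk N). left. auto. }
    destruct (classic (exists n, in_sort M n x)) as [[n Hn]|K].
    { apply (sort_iso_total _ _ (HR n)) in Hn as [y Hy]. exists y. right. left. eauto. }
    exfalso. apply Hx. split; auto. intros n Hn. eauto.
  - intros y. destruct (classic (branch N y)) as [Hx|Hx].
    { destruct (B3 y Hx) as [x Hy]. exists x. right. right. auto. }
    destruct (classic (y = junk N)) as [->|Hx'].
    { exists (junk M). left. auto. }
    destruct (classic (exists n, in_sort N n y)) as [[n Hn]|K].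
    { apply (sort_iso_surjective _ _ (HR n)) in Hn as [x Hy]. exists x. right. left. eauto. }
    exfalso. apply Hx. split; auto. intros n Hn. eauto.
  - intros x y x' y' Hxy Hxy'.
    destruct (classic (branch M x /\ branch M x')) as [[Hx Hx']|K].
    { pose proof (Hbr _ _ Hxy Hx) as Bx. pose proof (Hbr _ _ Hxy' Hx') as Bx'.
      destruct (B1 _ _ Bx) as [_ Hy], (B1 _ _ Bx') as [_ Hy'].
      split; intros ->.
      - apply (pr_separates _ _ _ HN); auto. intros n. apply (B4 _ _ _ _ n Bx Bx'). auto.
      - apply (pr_separates _ _ _ HM); auto. intros n. apply (B4 _ _ _ _ n Bx Bx'). auto. }
    destruct (classic (x = junk M)) as [Ex|Nx].
    { pose proof (proj1 (Hj _ _ Hxy) Ex) as Ey. subst.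
      split; intros E; symmetry; symmetry in E; apply (Hj _ _ Hxy'); auto. }
    destruct (classic (exists n, in_sort M n x)) as [[n Hn]|Ns].
    { split; intros E.
      - subst x'. apply (sort_iso_injective _ _ (HR n) x y x y'); auto.
      - subst y'. assert (Hn' : in_sort M n x') by (apply (Hs n _ _ Hxy'), (Hs n _ _ Hxy); auto).
        apply (sort_iso_injective _ _ (HR n) x y x' y); auto. }
    assert (Bx : branch M x) by (split; auto; intros n Hn; eauto).
    split; intros E; exfalso; subst; apply K; split; auto.
    apply (Hbr' _ _ Hxy'), (Hbr' _ _ Hxy). auto.
  - intros [n|n r] a b Hab.
    + simpl in a, b. specialize (Hab Fin.F1) as Hab1. specialize (Hs n _ _ Hab1).
      rewrite (fin1_constant _ a), (fin1_constant _ b). exact Hs.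
    + split; intros K.
      * pose proof (lift_rel_sort _ _ _ HM n r a K) as Ka.
        apply (sort_iso_rel _ _ (HR n) r a b); auto.
      * pose proof (lift_rel_sort _ _ _ HN n r b K) as Ka.
        apply (sort_iso_rel _ _ (HR n) r a b); auto.
        intros i. apply Hin; auto. apply (Hs n _ _ (Hab i)). auto.
  - intros [|n|n f] a b Hab.
    + left. unfold junk. split; f_equal; apply functional_extensionality; intros i; inversion i.
    + simpl in a, b. specialize (Hab Fin.F1) as Hab1.
      rewrite (fin1_constant _ a), (fin1_constant _ b). change (H (pr M n (a F1)) (pr N n (b F1))).
      destruct (classic (branch M (a F1))) as [K|K].
      * right. left. exists n. apply HB. auto.
      * left. split; [apply (pr_junk _ _ _ HM)|apply (pr_junk _ _ _ HN)]; auto.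
        rewrite <- (Hbr' _ _ Hab1). auto.
    + destruct (classic (forall i, in_sort M n (a i))) as [K|K].
      * right. left. exists n. apply (sort_iso_fn _ _ (HR n) f a b). auto.
      * left. split; [apply (lift_fn_junk _ _ _ HM)|apply (lift_fn_junk _ _ _ HN)]; auto.
        intros K'. apply K. intros i. apply (Hs n _ _ (Hab i)). auto.
Qed.

(** * Axiomatization *)

Definition fbigand {S : signature} (k : nat) (p : nat -> form S) : form S :=
  fconj (fun i => if lt_dec i k then p i else ftrue).

Definition fconj_list {S : signature} (l : list (form S)) : form S := fconj (fun n => nth n l ftrue).

Definition fconj_over {S : signature} {I : Type} (H : exists c : I -> nat, injective c)
    (p : I -> form S) : form S :=
  let (c, _) := constructive_indefinite_description _ H in
  fconj (fun n => match excluded_middle_informative (exists i, c i = n) with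
    | left E => p (proj1_sig (constructive_indefinite_description _ E))
    | right _ => ftrue
    end).

Lemma holds_fbigand (S : signature) (M : structure S) (k : nat) (p : nat -> form S) (a : nat -> M) :
  holds M a (fbigand k p) <-> forall i, i < k -> holds M a (p i).
Proof.
  unfold fbigand. cbn [holds]. split; intros H i; specialize (H i); destruct (lt_dec i k); auto; [tauto|].
  apply holds_ftrue.
Qed.

Lemma holds_fconj_list (S : signature) (M : structure S) (l : list (form S)) (a : nat -> M) :
  holds M a (fconj_list l) <-> Forall (holds M a) l.
Proof.
  unfold fconj_list. cbn [holds]. split.
  - intros H. apply Forall_forall. intros p Hp. apply In_nth with (d := ftrue) in Hp as (n & _ & <-). auto.
  - intros H n. destruct (lt_dec n (length l)) as [L|L].
    + apply (proj1 (Forall_forall _ _) H). apply nth_In. auto.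
    + rewrite nth_overflow by lia. apply holds_ftrue.
Qed.

Lemma holds_fconj_over (S : signature) (M : structure S) (I : Type) (E : exists c : I -> nat, injective c)
    (p : I -> form S) (a : nat -> M) :
  holds M a (fconj_over E p) <-> forall i, holds M a (p i).
Proof.
  unfold fconj_over. destruct (constructive_indefinite_description _ E) as [c Hc]. cbn [holds]. split.
  - intros H i. specialize (H (c i)). destruct (excluded_middle_informative _) as [E'|E']; [|exfalso; eauto].
    rewrite (Hc _ _ (proj2_sig (constructive_indefinite_description _ E'))) in H. auto.
  - intros H n. destruct (excluded_middle_informative _); auto. apply holds_ftrue.
Qed.

(** * Bounds on free variables *)

Definition term_below {S : signature} (k : nat) (t : term S) : Prop := forall v, tfree t v -> v < k.

Lemma below_ftrue (S : signature) (k : nat) : free_below k (@ftrue S).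
Proof. intros v Hv. apply free_ftrue in Hv. tauto. Qed.

Lemma below_fneg (S : signature) (k : nat) (p : form S) : free_below k p -> free_below k (fneg p).
Proof. auto. Qed.

Lemma below_fand (S : signature) (k : nat) (p q : form S) :
  free_below k p -> free_below k q -> free_below k (fand p q).
Proof. intros H1 H2 v Hv. apply free_fand in Hv as [Hv|Hv]; auto. Qed.

Lemma below_fimp (S : signature) (k : nat) (p q : form S) :
  free_below k p -> free_below k q -> free_below k (fimp p q).
Proof. intros H1 H2 v Hv. apply free_fimp in Hv as [Hv|Hv]; auto. Qed.

Lemma below_fconj (S : signature) (k : nat) (p : nat -> form S) :
  (forall n, free_below k (p n)) -> free_below k (fconj p).
Proof. intros H v [n Hv]. apply (H n v Hv). Qed.

Lemma below_fbigand (S : signature) (k m : nat) (p : nat -> form S) :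
  (forall i, i < m -> free_below k (p i)) -> free_below k (fbigand m p).
Proof. intros H. apply below_fconj. intros n. destruct (lt_dec n m); auto using below_ftrue. Qed.

Lemma below_fconj_over (S : signature) (k : nat) (I : Type) (E : exists c : I -> nat, injective c)
    (p : I -> form S) :
  (forall i, free_below k (p i)) -> free_below k (fconj_over E p).
Proof.
  intros H. unfold fconj_over. destruct (constructive_indefinite_description _ E) as [c Hc].
  apply below_fconj. intros n. destruct (excluded_middle_informative _); auto using below_ftrue.
Qed.

Lemma below_fconj_list (S : signature) (k : nat) (l : list (form S)) :
  Forall (free_below k) l -> free_below k (fconj_list l).
Proof.
  intros H. apply below_fconj. intros n. destruct (lt_dec n (length l)) as [L|L].
  - apply (proj1 (Forall_forall _ _) H). apply nth_In. auto.
  - rewrite nth_overflow by lia. apply below_ftrue.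
Qed.

Lemma below_fex (S : signature) (k : nat) (p : form S) : free_below (Datatypes.S k) p -> free_below k (fex k p).
Proof. intros H v [Hv1 Hv2]. apply H in Hv2. lia. Qed.

Lemma below_foralls (S : signature) (k : nat) (p : form S) : free_below k p -> free_below 0 (foralls k p).
Proof. intros H v Hv. destruct (sentence_foralls _ _ _ H v Hv). Qed.

Lemma below_feq (S : signature) (k : nat) (s t : term S) :
  term_below k s -> term_below k t -> free_below k (feq s t).
Proof. intros H1 H2 v [Hv|Hv]; auto. Qed.

Lemma below_frel (S : signature) (k : nat) (r : Rel S) (t : Fin.t (rel_ar S r) -> term S) :
  (forall i, term_below k (t i)) -> free_below k (frel r t).
Proof. intros H v [i Hv]. apply (H i v Hv). Qed.

Lemma below_tvar (S : signature) (k v : nat) : v < k -> term_below k (tvar S v).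
Proof. intros H w <-. auto. Qed.

Lemma below_tapp (S : signature) (k : nat) (f : Fn S) (t : Fin.t (fn_ar S f) -> term S) :
  (forall i, term_below k (t i)) -> term_below k (tapp f t).
Proof. intros H v [i Hv]. apply (H i v Hv). Qed.

Definition tjunk {S : signature} : term (tree_sig S) :=
  tapp (star : Fn (tree_sig S)) (fun _ => tvar (tree_sig S) 0).

Definition tproj {S : signature} (n : nat) (t : term (tree_sig S)) : term (tree_sig S) :=
  tapp (proj n : Fn (tree_sig S)) (fun _ => t).

Definition fbranch {S : signature} (t : term (tree_sig S)) : form (tree_sig S) :=
  fand (fneg (feq t tjunk)) (fconj (fun n => fneg (fsort n t))).

Definition fnode {S : signature} (P : Rel S) (n : nat) (t : term (tree_sig S)) : form (tree_sig S) :=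
  frel (lift_rel n P : Rel (tree_sig S)) (fun _ => t).

Lemma below_tjunk (S : signature) (k : nat) : term_below k (@tjunk S).
Proof. apply below_tapp. intros i. inversion i. Qed.

Lemma teval_tjunk (S : signature) (M : structure (tree_sig S)) (a : nat -> M) : teval M a tjunk = junk M.
Proof. unfold junk. simpl. f_equal. apply functional_extensionality. intros i. inversion i. Qed.

Lemma holds_fbranch (S : signature) (M : structure (tree_sig S)) (a : nat -> M) (t : term (tree_sig S)) :
  holds M a (fbranch t) <-> branch M (teval M a t).
Proof.
  unfold fbranch. rewrite holds_fand. cbn [holds]. rewrite teval_tjunk. reflexivity.
Qed.

(** The list follows the fields of [tree_like] in order. In the last axiom the variables up to [k]
    stand for the values of [a], of which only these matter, and variable [k + 1] for the new
    branch. *)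
Definition tree_axioms {S : signature} (p : form S) (P : Rel S) : list (form (tree_sig S)) :=
  let v := tvar (tree_sig S) in
  let vars k := fun i : Fin.t k => v (ordinal i) in
  [ fconj (fun n => fconj (fun m => if Nat.eq_dec n m then ftrue
      else foralls 1 (fneg (fand (fsort n (v 0)) (fsort m (v 0))))));
    fconj (fun n => fneg (fsort n tjunk));
    fconj (fun n => fex 0 (fsort n (v 0)));
    fconj (fun n => relativize n p);
    fconj (fun n => fconj_over (fn_countable S) (fun f => foralls (fn_ar S f)
      (fimp (fbigand (fn_ar S f) (fun i => fsort n (v i)))
        (fsort n (tapp (lift_fn n f : Fn (tree_sig S)) (vars _))))));
    fconj (fun n => fconj_over (fn_countable S) (fun f => foralls (fn_ar S f)
      (fimp (fneg (fbigand (fn_ar S f) (fun i => fsort n (v i))))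
        (feq (tapp (lift_fn n f : Fn (tree_sig S)) (vars _)) tjunk))));
    fconj (fun n => fconj_over (rel_countable S) (fun r => foralls (rel_ar S r)
      (fimp (frel (lift_rel n r : Rel (tree_sig S)) (vars _))
        (fbigand (rel_ar S r) (fun i => fsort n (v i))))));
    fex 0 (fbranch (v 0));
    fconj (fun n => foralls 1 (fimp (fbranch (v 0)) (fnode P n (tproj n (v 0)))));
    fconj (fun n => foralls 1 (fimp (fneg (fbranch (v 0))) (feq (tproj n (v 0)) tjunk)));
    fconj (fun n => foralls 1 (fimp (fnode P n (v 0))
      (fex 1 (fand (fbranch (v 1)) (feq (tproj n (v 1)) (v 0))))));
    fconj (fun n => foralls 2 (fimp (fbranch (v 0)) (fimp (fbranch (v 1))
      (fimp (feq (tproj (Datatypes.S n) (v 0)) (tproj (Datatypes.S n) (v 1)))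
        (feq (tproj n (v 0)) (tproj n (v 1)))))));
    foralls 2 (fimp (fbranch (v 0)) (fimp (fbranch (v 1))
      (fimp (fconj (fun n => feq (tproj n (v 0)) (tproj n (v 1)))) (feq (v 0) (v 1)))));
    fconj (fun n => fconj (fun k => foralls (Datatypes.S k) (fimp (fbranch (v k))
      (fex (Datatypes.S k) (fand (fbranch (v (Datatypes.S k)))
        (fand (fbigand n (fun m => feq (tproj m (v (Datatypes.S k))) (tproj m (v k))))
          (fbigand k (fun i => fneg (feq (tproj n (v (Datatypes.S k))) (tproj n (v i)))))))))))].

Definition tree_sentence {S : signature} (p : form S) (P : Rel S) : form (tree_sig S) :=
  fconj_list (tree_axioms p P).

Lemma below_relativize (S : signature) (k n : nat) (p : form S) : sentence p -> free_below k (relativize n p).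
Proof. intros H v Hv. destruct (sentence_relativize _ n _ H _ Hv). Qed.

Ltac solve_below := repeat (match goal with
  | |- free_below _ ftrue => apply below_ftrue
  | |- free_below _ (fneg _) => apply below_fneg
  | |- free_below _ (fand _ _) => apply below_fand
  | |- free_below _ (fimp _ _) => apply below_fimp
  | |- free_below _ (fconj _) => apply below_fconj
  | |- free_below _ (fbigand _ _) => apply below_fbigand
  | |- free_below _ (fconj_over _ _) => apply below_fconj_over
  | |- free_below _ (fex _ _) => apply below_fex
  | |- free_below _ (foralls _ _) => apply below_foralls
  | |- free_below _ (feq _ _) => apply below_feq
  | |- free_below _ (fsort _ _) => apply below_frel
  | |- free_below _ (fnode _ _ _) => apply below_frel
  | |- free_below _ (frel _ _) => apply below_frel
  | |- free_below _ (fbranch _) => unfold fbranch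
  | |- free_below _ (relativize _ _) => apply below_relativize; assumption
  | |- free_below _ (if ?c then _ else _) => destruct c
  | |- term_below _ tjunk => apply below_tjunk
  | |- term_below _ (tproj _ _) => apply below_tapp
  | |- term_below _ (tapp _ _) => apply below_tapp
  | |- term_below _ (tvar _ (ordinal _)) => apply below_tvar, ordinal_lt
  | |- term_below _ (tvar _ _) => apply below_tvar; lia
  end || intro).

Lemma sentence_tree_sentence (S : signature) (p : form S) (P : Rel S) :
  sentence p -> sentence (tree_sentence p P).
Proof.
  intros Hp. cut (free_below 0 (tree_sentence p P)); [intros H v Hv; apply H in Hv; lia|].
  apply below_fconj_list. unfold tree_axioms. repeat (apply Forall_cons); try apply Forall_nil; solve_below.
Qed.

Lemma upd_eq (S : signature) (M : structure S) (a : nat -> M) (x : nat) (m : M) : upd M a x m x = m.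
Proof. unfold upd. rewrite Nat.eqb_refl. auto. Qed.

Lemma upd_neq (S : signature) (M : structure S) (a : nat -> M) (x v : nat) (m : M) :
  v <> x -> upd M a x m v = a v.
Proof. intros H. unfold upd. rewrite (proj2 (Nat.eqb_neq v x)); auto. Qed.

Lemma forall_args (A : Type) (d : A) (k : nat) (Q : (Fin.t k -> A) -> Prop) :
  (forall a : nat -> A, Q (fun i => a (ordinal i))) <-> forall args, Q args.
Proof.
  split; intros H a; auto. specialize (H (extend d a)).
  replace (fun i => extend d a (ordinal i)) with a in H; auto.
  apply functional_extensionality. intros i. symmetry. apply extend_ordinal.
Qed.

Lemma holds_args_sort (S : signature) (M : structure (tree_sig S)) (a : nat -> M) (n k : nat) :
  holds M a (fbigand k (fun i => fsort n (tvar _ i))) <-> forall i : Fin.t k, in_sort M n (a (ordinal i)).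
Proof.
  rewrite holds_fbigand. split.
  - intros H i. apply (H (ordinal i)), ordinal_lt.
  - intros H i Hi. destruct (ordinal_surj k i Hi) as [j <-]. apply H.
Qed.

Lemma models_fconj (S : signature) (M : structure S) (p : nat -> form S) :
  models M (fconj p) <-> forall n, models M (p n).
Proof. reflexivity. Qed.

Lemma forall_iff (A : Type) (Q R : A -> Prop) :
  (forall x, Q x <-> R x) -> ((forall x, Q x) <-> (forall x, R x)).
Proof. firstorder. Qed.

Lemma exists_iff (A : Type) (Q R : A -> Prop) :
  (forall x, Q x <-> R x) -> ((exists x, Q x) <-> (exists x, R x)).
Proof. firstorder. Qed.

Lemma imp_iff (A B C : Prop) : (A -> (B <-> C)) -> ((A -> B) <-> (A -> C)).
Proof. tauto. Qed.

Lemma and_iff (A B C D : Prop) : (A <-> C) -> (B <-> D) -> (A /\ B <-> C /\ D).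
Proof. tauto. Qed.

Lemma forall_iff1 (A : Type) (Q : (nat -> A) -> Prop) (R : A -> Prop) :
  (forall a, Q a <-> R (a 0)) -> ((forall a, Q a) <-> (forall x, R x)).
Proof. intros H. split; intros G a; [apply (H (fun _ => a))|apply H]; auto. Qed.

Lemma forall_iff2 (A : Type) (Q : (nat -> A) -> Prop) (R : A -> A -> Prop) :
  (forall a, Q a <-> R (a 0) (a 1)) -> ((forall a, Q a) <-> (forall x y, R x y)).
Proof.
  intros H. split; intros G a; [|apply H; auto].
  intros b. apply (H (fun n => match n with 0 => a | _ => b end)). auto.
Qed.

Lemma forall_iff_args (A : Type) (d : A) (k : nat) (Q : (nat -> A) -> Prop) (R : (Fin.t k -> A) -> Prop) :
  (forall a, Q a <-> R (fun i => a (ordinal i))) -> ((forall a, Q a) <-> (forall args, R args)).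
Proof. intros H. rewrite <- (forall_args A d). apply forall_iff. auto. Qed.

Lemma models_tree_sentence (S : signature) (p : form S) (P : Rel S) (M : structure (tree_sig S)) :
  models M (tree_sentence p P) <-> tree_like p P M.
Proof.
  (* The record is unfolded into a conjunction; the final [True] matches [Forall] over the empty
     list, so both sides split clause by clause. *)
  assert (E : tree_like p P M <->
    (forall n m x, in_sort M n x -> in_sort M m x -> n = m) /\
    (forall n, ~ in_sort M n (junk M)) /\
    (forall n, exists x, in_sort M n x) /\
    (forall n, models M (relativize n p)) /\
    (forall n f args, (forall i, in_sort M n (args i)) ->
      in_sort M n (fn_in M n f args)) /\
    (forall n f args, ~ (forall i, in_sort M n (args i)) ->
      fn_in M n f args = junk M) /\
    (forall n r args, rel_in M n r args -> forall i, in_sort M n (args i)) /\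
    (exists b, branch M b) /\
    (forall n b, branch M b -> node P M n (pr M n b)) /\
    (forall n x, ~ branch M x -> pr M n x = junk M) /\
    (forall n x, node P M n x -> exists b, branch M b /\ pr M n b = x) /\
    (forall n b c, branch M b -> branch M c ->
      pr M (Datatypes.S n) b = pr M (Datatypes.S n) c -> pr M n b = pr M n c) /\
    (forall b c, branch M b -> branch M c -> (forall n, pr M n b = pr M n c) -> b = c) /\
    (forall n k (a : nat -> M), branch M (a k) -> exists c, branch M c /\
      (forall m, m < n -> pr M m c = pr M m (a k)) /\ (forall i, i < k -> pr M n c <> pr M n (a i))) /\ True).
  { split; [intros []; tauto|]. intros (?&?&?&?&?&?&?&?&?&?&?&?&?&?&_). constructor; auto. }
  rewrite E. clear E.
  unfold tree_sentence, models at 1. rewrite holds_fconj_list. unfold tree_axioms.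
  rewrite !Forall_cons_iff.
  change (holds M (fun _ => inhab M)) with (models M).
  repeat apply and_iff.
  - rewrite models_fconj. apply forall_iff; intros n. rewrite models_fconj. apply forall_iff; intros m.
    destruct (Nat.eq_dec n m) as [->|Hnm]; [split; auto; intros _; apply holds_ftrue|].
    rewrite models_foralls by solve_below. apply forall_iff1; intros a. cbn [holds]. rewrite holds_fand.
    change (~ (in_sort M n (a 0) /\ in_sort M m (a 0)) <-> (in_sort M n (a 0) -> in_sort M m (a 0) -> n = m)).
    tauto.
  - rewrite models_fconj. apply forall_iff; intros n. unfold models. cbn [holds fsort teval].
    rewrite teval_tjunk. reflexivity.
  - reflexivity.
  - reflexivity.
  - rewrite models_fconj. apply forall_iff; intros n. unfold models. rewrite holds_fconj_over.
    apply forall_iff; intros f. change (holds M (fun _ => inhab M)) with (models M).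
    rewrite models_foralls by solve_below. apply (forall_iff_args M (inhab M)); intros a.
    rewrite holds_fimp, holds_args_sort. reflexivity.
  - rewrite models_fconj. apply forall_iff; intros n. unfold models. rewrite holds_fconj_over.
    apply forall_iff; intros f. change (holds M (fun _ => inhab M)) with (models M).
    rewrite models_foralls by solve_below. apply (forall_iff_args M (inhab M)); intros a.
    rewrite holds_fimp. cbn [holds]. rewrite holds_args_sort, teval_tjunk. reflexivity.
  - rewrite models_fconj. apply forall_iff; intros n. unfold models. rewrite holds_fconj_over.
    apply forall_iff; intros r. change (holds M (fun _ => inhab M)) with (models M).
    rewrite models_foralls by solve_below. apply (forall_iff_args M (inhab M)); intros a.
    rewrite holds_fimp, holds_args_sort. reflexivity.
  - unfold models. cbn [holds]. apply exists_iff; intros x.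
    rewrite holds_fbranch. cbn [teval]. rewrite upd_eq. reflexivity.
  - rewrite models_fconj. apply forall_iff; intros n. rewrite models_foralls by solve_below.
    apply forall_iff1; intros a. rewrite holds_fimp, holds_fbranch. reflexivity.
  - rewrite models_fconj. apply forall_iff; intros n. rewrite models_foralls by solve_below.
    apply forall_iff1; intros a. rewrite holds_fimp. cbn [holds].
    rewrite holds_fbranch, teval_tjunk. reflexivity.
  - rewrite models_fconj. apply forall_iff; intros n. rewrite models_foralls by solve_below.
    apply forall_iff1; intros a. rewrite holds_fimp. apply imp_iff; intros _. cbn [holds].
    apply exists_iff; intros b. rewrite holds_fand, holds_fbranch. reflexivity.
  - rewrite models_fconj. apply forall_iff; intros n. rewrite models_foralls by solve_below.
    apply forall_iff2; intros a. rewrite !holds_fimp, !holds_fbranch. reflexivity.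
  - rewrite models_foralls by solve_below.
    apply forall_iff2; intros a. rewrite !holds_fimp, !holds_fbranch. reflexivity.
  - rewrite models_fconj. apply forall_iff; intros n. rewrite models_fconj. apply forall_iff; intros k.
    rewrite models_foralls by solve_below.
    apply forall_iff; intros a. rewrite holds_fimp, holds_fbranch. apply imp_iff; intros _.
    cbn [holds]. apply exists_iff; intros c. rewrite !holds_fand, holds_fbranch, !holds_fbigand.
    cbn [teval]. rewrite upd_eq. apply and_iff; [reflexivity|].
    apply and_iff; apply forall_iff; intros i; apply imp_iff; intros Hi.
    + change (pr M i (upd M a (Datatypes.S k) c (Datatypes.S k)) = pr M i (upd M a (Datatypes.S k) c k) <->
        pr M i c = pr M i (a k)).
      rewrite upd_eq, upd_neq by lia. reflexivity.
    + change (pr M n (upd M a (Datatypes.S k) c (Datatypes.S k)) <> pr M n (upd M a (Datatypes.S k) c i) <->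
        pr M n c <> pr M n (a i)).
      rewrite upd_eq, upd_neq by lia. reflexivity.
  - split; auto.
Qed.

(** * The full tree *)

Inductive full_tree (A L : Type) : Type :=
| tree_junk : full_tree A L
| tree_sort : nat -> A -> full_tree A L
| tree_branch : (nat -> L) -> full_tree A L.
Arguments tree_junk {A L}.
Arguments tree_sort {A L} n x.
Arguments tree_branch {A L} b.

(** The same [A] serves on every level, and every sequence over [L] is a branch. [enc n b] is the
    element of [A] that represents the first [n + 1] values of [b]. *)
Definition full_tree_model {S : signature} (A : structure S) (L : Type) (enc : nat -> (nat -> L) -> A) :
  structure (tree_sig S) :=
  Build_structure (tree_sig S) (carrier := full_tree A L) tree_junk
    (fun r : tree_rel S => match r return (Fin.t (tree_rel_ar r) -> full_tree A L) -> Prop with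
      | sort n => fun args => exists x, tree_sort n x = args Fin.F1
      | lift_rel n r => fun args => exists xs, (fun i => tree_sort n (xs i)) = args /\ rel_int A r xs
      end)
    (fun f : tree_fn S => match f return (Fin.t (tree_fn_ar f) -> full_tree A L) -> full_tree A L with
      | star => fun _ => tree_junk
      | proj n => fun args => match args Fin.F1 with tree_branch b => tree_sort n (enc n b) | _ => tree_junk end
      | lift_fn n f => fun args =>
          match excluded_middle_informative (exists xs, (fun i => tree_sort n (xs i)) = args) with
          | left E => tree_sort n (fn_int A f (proj1_sig (constructive_indefinite_description _ E)))
          | right _ => tree_junk
          end
      end).

Lemma tree_sort_family (A L : Type) (n k : nat) (xs ys : Fin.t k -> A) :
  (fun i => tree_sort (L := L) n (xs i)) = (fun i => tree_sort n (ys i)) -> xs = ys.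
Proof.
  intros E. apply functional_extensionality. intros i. apply (f_equal (fun f => f i)) in E. congruence.
Qed.

Lemma full_tree_copy (S : signature) (A : structure S) (L : Type) (enc : nat -> (nat -> L) -> A) (n : nat) :
  copy (M := full_tree_model A L enc) n (tree_sort n).
Proof.
  split; [|split; [|split]].
  - intros x y E. congruence.
  - intros x. reflexivity.
  - intros r args. simpl. split; [eauto|]. intros (xs & E & H). apply tree_sort_family in E. subst. auto.
  - intros f args. simpl. destruct (excluded_middle_informative _) as [E|E]; [|exfalso; eauto].
    destruct (constructive_indefinite_description _ E) as [xs Hxs]. simpl.
    apply tree_sort_family in Hxs. subst. auto.
Qed.

Lemma infinite_fresh (L : Type) (l : list L) : infinite_type L -> exists x, ~ In x l.
Proof.
  intros [i Hi]. apply NNPP. intros H.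
  assert (K : incl (map i (seq 0 (Datatypes.S (length l)))) l).
  { intros x _. apply NNPP. intros Hx. eauto. }
  apply NoDup_incl_length in K.
  - rewrite length_map, length_seq in K. lia.
  - apply FinFun.Injective_map_NoDup; [exact Hi|apply seq_NoDup].
Qed.

Lemma full_tree_branch (S : signature) (A : structure S) (L : Type) (enc : nat -> (nat -> L) -> A)
    (x : full_tree A L) :
  branch (full_tree_model A L enc) x <-> exists b, x = tree_branch b.
Proof.
  split.
  - intros [H1 H2]. destruct x as [|n x|b]; eauto; [destruct H1; reflexivity|].
    destruct (H2 n). exists x. reflexivity.
  - intros [b ->]. split; [discriminate|]. intros n [x E]. discriminate.
Qed.

(** The conditions on [enc] make the elements of [P] in [A] correspond, for each [n], exactly to the
    sequences of length [n + 1] over [L]. Splitting holds because one value of a sequence can be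
    changed freely. *)
Lemma full_tree_like (S : signature) (p : form S) (P : Rel S) (A : structure S) (L : Type)
    (enc : nat -> (nat -> L) -> A) :
  rel_ar S P = 1 -> sentence p -> models A p -> infinite_type L ->
  (forall n b, Pset A P (enc n b)) -> (forall n x, Pset A P x -> exists b, enc n b = x) ->
  (forall n b c, enc n b = enc n c <-> forall m, m <= n -> b m = c m) ->
  tree_like p P (full_tree_model A L enc).
Proof.
  intros HP Hp HA HL Enode Esurj Einj.
  assert (Hcopy := full_tree_copy S A L enc).
  assert (junk0 : junk (full_tree_model A L enc) = tree_junk) by reflexivity.
  assert (prE : forall n b, pr (full_tree_model A L enc) n (tree_branch b) = tree_sort n (enc n b)) by reflexivity.
  assert (node_sort : forall n x, node P (full_tree_model A L enc) n x -> exists y, x = tree_sort n y).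
  { intros n x (xs & E & _). assert (i : Fin.t (rel_ar S P)) by (rewrite HP; exact Fin.F1).
    exists (xs i). apply (f_equal (fun f => f i)) in E. auto. }
  assert (fbranch : forall b, branch (full_tree_model A L enc) (tree_branch b)).
  { intros b. apply full_tree_branch. eauto. }
  constructor.
  - intros n m x [y E] [z E']. congruence.
  - intros n [x E]. rewrite junk0 in E. discriminate.
  - intros n. exists (tree_sort n (inhab A)), (inhab A). reflexivity.
  - intros n. apply (copy_models _ _ _ _ _ _ (Hcopy n) Hp). auto.
  - intros n f args H. destruct (choice_fun _ _ _ H) as [xs Hxs].
    replace args with (fun i => tree_sort (L := L) n (xs i)) by (apply functional_extensionality; auto).
    rewrite <- (proj2 (proj2 (proj2 (Hcopy n)))). eexists. reflexivity.
  - intros n f args H. simpl. destruct (excluded_middle_informative _) as [[xs <-]|E]; [|reflexivity].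
    destruct H. intros i. exists (xs i). reflexivity.
  - intros n r args (xs & <- & _) i. exists (xs i). reflexivity.
  - destruct HL as [i _]. exists (tree_branch (fun _ => i 0)). auto.
  - intros n b Hb. apply full_tree_branch in Hb as [b' ->]. rewrite prE.
    apply (copy_node _ _ _ _ _ _ _ (Hcopy n)). auto.
  - intros n [|m x|b] Hx; try reflexivity. destruct Hx. auto.
  - intros n x Hx. destruct (node_sort n x Hx) as [y ->]. apply (copy_node _ _ _ _ _ _ _ (Hcopy n)) in Hx.
    destruct (Esurj n y Hx) as [b <-]. exists (tree_branch b). auto.
  - intros n b c Hb Hc. apply full_tree_branch in Hb as [b' ->]. apply full_tree_branch in Hc as [c' ->].
    rewrite !prE. intros E. injection E as E. rewrite Einj in E. f_equal. apply Einj. auto.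
  - intros b c Hb Hc. apply full_tree_branch in Hb as [b' ->]. apply full_tree_branch in Hc as [c' ->].
    intros E. f_equal. apply functional_extensionality. intros n. specialize (E n). rewrite !prE in E.
    injection E as E. rewrite Einj in E. auto.
  - intros n k a Hb. apply full_tree_branch in Hb as [b Hb]. rewrite Hb.
    (* [x] differs from the value at [n] of every listed branch and replaces [b n]; the entry [b n]
       for a non-branch is only a filler. *)
    destruct (infinite_fresh L (map (fun i => match a i with tree_branch d => d n | _ => b n end) (seq 0 k)) HL)
      as [x Hx].
    exists (tree_branch (fun m => if Nat.eq_dec m n then x else b m)). split; [auto|]. split.
    + intros m Hm. rewrite !prE. f_equal. apply Einj. intros i Hi. destruct (Nat.eq_dec i n); auto. lia.
    + intros i Hi E. destruct (a i) as [|m y|d] eqn:Ea; try discriminate E.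
      rewrite !prE in E. injection E as E. rewrite Einj in E. specialize (E n (le_n n)).
      destruct (Nat.eq_dec n n); [|tauto]. apply Hx. apply in_map_iff. exists i. rewrite Ea. split; auto.
      apply in_seq. lia.
Qed.

(** Iterated pairing of the first [n + 1] values. With a bijective [q] every element of [L] is a
    code, which is needed for every element of [P] to lie on a branch. *)
Fixpoint prefix_code {L : Type} (q : L * L -> L) (n : nat) (b : nat -> L) : L :=
  match n with 0 => b 0 | Datatypes.S n => q (prefix_code q n b, b (Datatypes.S n)) end.

Lemma prefix_code_eq (L : Type) (q : L * L -> L) (n : nat) (b c : nat -> L) :
  injective q -> (prefix_code q n b = prefix_code q n c <-> forall m, m <= n -> b m = c m).
Proof.
  intros Hq. induction n as [|n IH]; simpl.
  - split; [|auto]. intros E m Hm. replace m with 0 by lia. auto.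
  - split.
    + intros E m Hm. apply Hq, pair_equal_spec in E as [E1 E2]. rewrite IH in E1.
      destruct (Nat.eq_dec m (Datatypes.S n)) as [->|]; auto. apply E1. lia.
    + intros H. f_equal. f_equal; auto. apply IH. auto.
Qed.

Lemma prefix_code_surjective (L : Type) (q : L * L -> L) (n : nat) :
  bijective q -> surjective (prefix_code q n).
Proof.
  intros [Hi Hs]. induction n as [|n IH]; intros x; [exists (fun _ => x); auto|].
  destruct (Hs x) as [[y z] <-]. destruct (IH y) as [b <-].
  exists (fun m => if Nat.eq_dec m (Datatypes.S n) then z else b m). cbn [prefix_code].
  destruct (Nat.eq_dec (Datatypes.S n) (Datatypes.S n)) as [_|]; [|tauto]. f_equal. f_equal.
  apply prefix_code_eq; auto. intros m Hm. destruct (Nat.eq_dec m (Datatypes.S n)); auto. lia.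
Qed.

(** A bijection of [L * L] with [L] codes finite sequences by single elements of [L], which a
    bijection with [P] turns into nodes. *)
Lemma tree_like_exists (S : signature) (p : form S) (P : Rel S) (A : structure S) (L : Type) :
  rel_ar S P = 1 -> sentence p -> models A p -> infinite_type L -> same_card {x | Pset A P x} L ->
  exists M : structure (tree_sig S), tree_like p P M /\ le_card (nat -> L) M.
Proof.
  intros HP Hp HA HL (f & Hi & Hs).
  assert (Hq : same_card (L * L) L).
  { apply cantor_bernstein; [apply infinite_square; auto|].
    exists (fun x => (x, x)). intros x y E. congruence. }
  destruct Hq as (q & Hq). pose proof (fun n => prefix_code_surjective L q n Hq) as C1.
  pose proof (fun n b c => prefix_code_eq L q n b c (proj1 Hq)) as C2.
  destruct (choice_fun _ _ _ Hs) as [g Hg].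
  exists (full_tree_model A L (fun n b => proj1_sig (g (prefix_code q n b)))). split.
  - apply full_tree_like; auto.
    + intros n b. apply proj2_sig.
    + intros n x Hx. destruct (C1 n (f (exist _ x Hx))) as [b Hb]. exists b. rewrite Hb.
      change x with (proj1_sig (exist (Pset A P) x Hx)). f_equal. apply Hi. auto.
    + intros n b c. rewrite <- C2. split; [|congruence]. intros E.
      rewrite <- (Hg (prefix_code q n b)), <- (Hg (prefix_code q n c)). f_equal.
      apply proj1_sig_inj. auto.
  - exists tree_branch. intros b c E. congruence.
Qed.

(** * Upper bound, completeness and conclusion *)

Lemma tree_like_bound (S : signature) (p : form S) (P : Rel S) (M : structure (tree_sig S)) (L : Type) :
  infinite_type L -> rel_ar S P = 1 -> sentence p -> (forall A : structure S, models A p -> le_card A L) ->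
  tree_like p P M -> le_card M (nat -> L).
Proof.
  intros [i Hi] HP Hp Hcard HM.
  assert (Hc : forall n, exists c : M -> L, forall x y, in_sort M n x -> in_sort M n y -> c x = c y -> x = y).
  { intros n. destruct (sort_copy _ _ _ _ n HM) as (A & j & Hj).
    destruct (Hcard A) as [c Hc].
    { apply (copy_models _ _ _ _ _ _ Hj Hp), (sort_models _ _ _ HM). }
    destruct Hj as (J1 & J2 & _).
    exists (fun x => c (epsilon (inhabits (inhab A)) (fun y => j y = x))). intros x y Hx Hy E.
    apply Hc in E. apply J2, (epsilon_spec (inhabits (inhab A))) in Hx, Hy.
    congruence. }
  destruct (choice_fun _ _ _ Hc) as [c Hcc].
  (* Entry 0 is a tag: [i 0] for a branch, followed by the codes of its nodes; [i 1] for junk; [i 2]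
     for an element of a sort, followed by its level and its code there. *)
  destruct (choice_fun M (nat -> L) (fun x s =>
      (s 0 = i 0 /\ branch M x /\ forall n, s (Datatypes.S n) = c n (pr M n x)) \/
      (s 0 = i 1 /\ x = junk M) \/
      (exists n, s 0 = i 2 /\ in_sort M n x /\ s 1 = i n /\ s 2 = c n x))) as [s Hs].
  { intros x. destruct (classic (branch M x)) as [Hx|Hx].
    { exists (fun n => match n with 0 => i 0 | Datatypes.S n => c n (pr M n x) end). auto. }
    destruct (classic (x = junk M)) as [->|Hx'].
    { exists (fun _ => i 1). auto. }
    destruct (classic (exists n, in_sort M n x)) as [[n Hn]|K].
    { exists (fun m => match m with 0 => i 2 | 1 => i n | _ => c n x end). right. right. exists n. auto. }
    exfalso. apply Hx. split; auto. intros n Hn. eauto. }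
  exists s. intros x y E.
  destruct (Hs x) as [(X1 & X2 & X3)|[(X1 & X2)|(n & X1 & X2 & X3 & X4)]],
    (Hs y) as [(Y1 & Y2 & Y3)|[(Y1 & Y2)|(m & Y1 & Y2 & Y3 & Y4)]]; rewrite E in *;
    rewrite X1 in Y1; apply Hi in Y1; try discriminate Y1.
  - apply (pr_separates _ _ _ HM); auto. intros n. apply (Hcc n).
    + apply (node_sort _ p P); auto. apply (pr_node _ _ _ HM); auto.
    + apply (node_sort _ p P); auto. apply (pr_node _ _ _ HM); auto.
    + rewrite <- X3, <- Y3. auto.
  - congruence.
  - rewrite X3 in Y3. apply Hi in Y3. subst m. apply (Hcc n); auto. congruence.
Qed.

Lemma complete_tree_sentence (S : signature) (p : form S) (P : Rel S) :
  rel_ar S P = 1 -> sentence p -> complete p -> homogeneous_countable p P -> complete (tree_sentence p P).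
Proof.
  intros HP Sp Cp Hp t St.
  assert (sand : forall q, sentence q -> sentence (fand (tree_sentence p P) q)).
  { intros q Hq v Hv. apply free_fand in Hv as [Hv|Hv]; [|destruct (Hq v Hv)].
    destruct (sentence_tree_sentence _ _ P Sp v Hv). }
  assert (down : forall M q, sentence q -> models M (tree_sentence p P) -> models M q ->
     exists N : structure (tree_sig S), tree_like p P N /\ same_card N nat /\ models N q).
  { intros M q Hq HM Hmq.
    (* Only the truth of one given sentence passes to the countable structure, so [q] is joined to
       the tree sentence. *)
    destruct (lowenheim_skolem _ M (fand (tree_sentence p P) q) nat) as (N & HN & CN); auto.
    - exists (fun n => n). intros x y E. auto.
    - apply models_tree_sentence in HM. eapply tree_like_infinite; eauto.
    - exists N. unfold models in HN. rewrite !holds_fand in HN. destruct HN as [_ HN].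
      destruct HN as [H1 H2]; auto. split; [apply models_tree_sentence; auto|auto]. }
  destruct (classic (exists M, models M (tree_sentence p P) /\ models M t)) as [(M & HM & Mt)|H].
  - left. intros N HN. apply NNPP. intros Nt.
    destruct (down M t St HM Mt) as (M' & TM & CM & M't).
    destruct (down N (fneg t) St HN Nt) as (N' & TN & CN & N't).
    destruct (tree_like_isomorphism S p P M' N') as [R HR]; auto.
    apply N't. apply (isomorphism_models _ _ _ _ _ HR St). auto.
  - right. intros M HM Mt. eauto.
Qed.

Theorem theorem3p3 (L : Type) :
  infinite_type L -> homogeneously_characterizable L ->
  completely_characterizable (nat -> L).
Proof.
  intros HL (S & p & P & HP & Sp & Cp & Hcard & _ & Hhom & A & HA & HAL).
  exists (tree_sig S), (tree_sentence p P).
  split; [apply sentence_tree_sentence; auto|].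
  split; [apply complete_tree_sentence; auto|].
  split.
  (* The full tree serves only as a model with at least lambda^omega elements; a model of exactly
     this size is obtained by Loewenheim-Skolem as well. *)
  - intros X HX HXL.
    destruct (tree_like_exists S p P A L HP Sp HA HL HAL) as (M & HM & LM).
    destruct (lowenheim_skolem _ M (tree_sentence p P) X (sentence_tree_sentence _ _ P Sp) HX) as (N & HN & CN).
    + eapply le_card_trans; eauto.
    + exists N. split; auto. apply HN, models_tree_sentence. auto.
  - intros (M & HM & [_ Hlt] & _). apply Hlt. apply models_tree_sentence in HM.
    eapply tree_like_bound; eauto.
Qed.
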